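(* Let $\Gamma=G\ast_HG$ be an amalgamated product, where $G$ and $H$ satisfy one of the following conditions: (a) $G$ is isomorphic to $\mathbb{Z}_{4q}$ or $\mathrm{Dic}_{4q}$ and $H$ is isomorphic to $\mathbb{Z}_{2q}$. (b) $G$ is isomorphic to $\mathrm{Dic}_{4q}$, $q\ge6$ is even and $H$ is isomorphic to $\mathrm{Dic}_{2q}$. (c) $q=4$, $G\cong\mathcal{Q}_{16}$, $H\cong\mathcal{Q}_8$ and $\Gamma$ is isomorphic to $K_1$. (d) $G$ is isomorphic to $O^*$ and $H$ is isomorphic to $T^*$. Then $\Gamma\cong\mathbb{Z}\rtimes G$, where $$gtg^{-1}=\begin{cases}t&\text{if } g\in H\\ t^{-1}&\text{if } g\in G\setminus H,\end{cases}$$ $t$ being a generator of the $\mathbb{Z}$-factor.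
   Context: $\mathbb{Z}_m$ is the cyclic group of order $m$; for $m\ge2$, $\mathrm{Dic}_{4m}=\langle x,y\mid x^m=y^2,\ yxy^{-1}=x^{-1}\rangle$ is the dicyclic group of order $4m$; $\mathcal{Q}_8=\mathrm{Dic}_8$, $\mathcal{Q}_{16}=\mathrm{Dic}_{16}$; $T^*$ and $O^*$ are the binary tetrahedral and octahedral groups. In $G\ast_HG$, $H$ is embedded as an index $2$ subgroup of each copy of $G$ (by possibly different embeddings), and in the conclusion $H$ is regarded as a subgroup of $G$ via such an embedding. The group $K_1$, which is of the form $\mathcal{Q}_{16}\ast_{\mathcal{Q}_8}\mathcal{Q}_{16}$, is $$K_1=\langle x,y,a,b\mid x^4=y^2,\ a^4=b^2,\ yxy^{-1}=x^{-1},\ bab^{-1}=a^{-1},\ x^2=a^2,\ y=b\rangle.$$ *)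

(* Defs.v *)
From HB Require Import structures.
From mathcomp Require Import all_boot all_order all_algebra all_fingroup.
From mathcomp Require Import boolp.

Set Implicit Arguments.
Unset Strict Implicit.
Unset Printing Implicit Defensive.

Import GroupScope.
Local Open Scope quotient_scope.
Local Open Scope group_scope.

(* The bare name repr is shadowed by the set representative of fingroup. *)
Local Notation quot_repr := generic_quotient.repr.

Definition isomorphic (A B : groupType) : Prop :=
  exists f : {multiplicative A -> B}, bijective f.

(* Formal group expressions in generators X. They carry the operations 1, *,
   ^-1 (hence also ^+) so that relations can be written in the usual notation,
   but satisfy no group law before the quotient below is taken. *)
Inductive gterm (X : Type) : Type :=
  | Gen of X
  | GOne
  | GMul of gterm X & gterm X
  | GInv of gterm X.
Arguments GOne {X}.

Section GTerm.
Variable X : Type.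
HB.instance Definition _ := gen_eqMixin (gterm X).
HB.instance Definition _ := gen_choiceMixin (gterm X).
HB.instance Definition _ := hasMul.Build (gterm X) (@GMul X).
HB.instance Definition _ := hasOne.Build (gterm X) (@GOne X).
HB.instance Definition _ := hasInv.Build (gterm X) (@GInv X).
End GTerm.

Section Presented.
Variables (X : Type) (R : gterm X -> gterm X -> Prop).

(* The least congruence containing the relations R and the group laws. *)
Inductive gterm_eq : gterm X -> gterm X -> Prop :=
  | geq_rel u v of R u v : gterm_eq u v
  | geq_refl u : gterm_eq u u
  | geq_sym u v of gterm_eq u v : gterm_eq v u
  | geq_trans u v w of gterm_eq u v & gterm_eq v w : gterm_eq u w
  | geq_mul u u' v v' of gterm_eq u u' & gterm_eq v v' :
      gterm_eq (u * v) (u' * v')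
  | geq_inv u u' of gterm_eq u u' : gterm_eq u^-1 u'^-1
  | geq_mulA u v w : gterm_eq (u * (v * w)) (u * v * w)
  | geq_mul1 u : gterm_eq (1 * u) u
  | geq_mulV u : gterm_eq (u^-1 * u) 1.

Definition gterm_eqb (u v : gterm X) : bool := `[< gterm_eq u v >].

Lemma gterm_eqb_refl : reflexive gterm_eqb.
Proof. by move=> u; apply/asboolP/geq_refl. Qed.

Lemma gterm_eqb_sym : symmetric gterm_eqb.
Proof. by move=> u v; apply/asboolP/asboolP => /geq_sym. Qed.

Lemma gterm_eqb_trans : transitive gterm_eqb.
Proof.
by move=> v u w /asboolP uv /asboolP vw; apply/asboolP/(geq_trans uv vw).
Qed.

Canonical gterm_equiv : equiv_rel (gterm X) :=
  EquivRel gterm_eqb gterm_eqb_refl gterm_eqb_sym gterm_eqb_trans.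

Definition presented : Type := {eq_quot gterm_equiv}.
HB.instance Definition _ := Choice.on presented.
HB.instance Definition _ := EqQuotient.on presented.

Definition pclass (u : gterm X) : presented := \pi_presented u.

Definition pres_one : presented := pclass 1.
Definition pres_mul (a b : presented) : presented :=
  pclass (quot_repr a * quot_repr b).
Definition pres_inv (a : presented) : presented := pclass (quot_repr a)^-1.

Lemma pclassP u v : pclass u = pclass v <-> gterm_eq u v.
Proof.
split=> [/eqmodP /= /asboolP //|uv].
by apply/eqmodP/asboolP.
Qed.

Lemma repr_pclass u : gterm_eq (quot_repr (pclass u)) u.
Proof. by apply/pclassP; rewrite /pclass reprK. Qed.

Lemma pclass_repr a : pclass (quot_repr a) = a.
Proof. by rewrite /pclass reprK. Qed.

Lemma pclassM u v : pclass (u * v) = pres_mul (pclass u) (pclass v).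
Proof.
by apply/pclassP; apply: geq_mul; apply: geq_sym; apply: repr_pclass.
Qed.

Lemma pclassV u : pclass u^-1 = pres_inv (pclass u).
Proof. by apply/pclassP; apply: geq_inv; apply/geq_sym/repr_pclass. Qed.

Fact pres_mulA : associative pres_mul.
Proof.
move=> a b c; rewrite -(pclass_repr a) -(pclass_repr b) -(pclass_repr c).
by rewrite -!pclassM; apply/pclassP/geq_mulA.
Qed.

Fact pres_mul1 : left_id pres_one pres_mul.
Proof.
by move=> a; rewrite -(pclass_repr a) -pclassM; apply/pclassP/geq_mul1.
Qed.

Fact pres_mulV : left_inverse pres_one pres_inv pres_mul.
Proof.
by move=> a; rewrite -(pclass_repr a) -pclassV -pclassM; apply/pclassP/geq_mulV.
Qed.

Fact pres_mulgV : right_inverse pres_one pres_inv pres_mul.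
Proof.
move=> a; rewrite -[LHS]pres_mul1 -{1}(pres_mulV (pres_inv a)) -pres_mulA.
by rewrite [X in pres_mul _ X]pres_mulA pres_mulV pres_mul1 pres_mulV.
Qed.

Fact pres_mulg1 : right_id pres_one pres_mul.
Proof. by move=> a; rewrite -(pres_mulV a) pres_mulA pres_mulgV pres_mul1. Qed.

HB.instance Definition _ := isGroup.Build presented
  pres_mulA pres_mul1 pres_mulg1 pres_mulV pres_mulgV.

Definition pgen (i : X) : presented := pclass (Gen i).

End Presented.

(* A *_K B for f : K -> A and g : K -> B: the generators are the elements of
   A and of B, subject to the multiplication tables of A and B and to the
   identification of f k with g k. It is the pushout for arbitrary morphisms
   f, g, and the amalgamated product when both are injective. *)
Section Amalgam.
Variables (K A B : groupType) (f : K -> A) (g : K -> B).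

Inductive amalgam_rel : gterm (A + B) -> gterm (A + B) -> Prop :=
  | amalgam_mull (a a' : A) :
      amalgam_rel (Gen (inl a) * Gen (inl a')) (Gen (inl (a * a')))
  | amalgam_mulr (b b' : B) :
      amalgam_rel (Gen (inr b) * Gen (inr b')) (Gen (inr (b * b')))
  | amalgam_glue (k : K) :
      amalgam_rel (Gen (inl (f k))) (Gen (inr (g k))).

Definition amalgam : Type := presented amalgam_rel.
HB.instance Definition _ := Group.on amalgam.
End Amalgam.

Variant dic_gen := Dic_x | Dic_y.

Section Dicyclic.
Variable m : nat.
Let x := Gen Dic_x.
Let y := Gen Dic_y.
Variant dic_rel : gterm dic_gen -> gterm dic_gen -> Prop :=
  | Dic_pow : dic_rel (x ^+ m) (y ^+ 2)
  | Dic_conj : dic_rel (y * x * y^-1) x^-1.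

(* The dicyclic group Dic_{4m}: it has order 4m, the parameter is m. *)
Definition dicyclic : Type := presented dic_rel.
HB.instance Definition _ := Group.on dicyclic.
End Dicyclic.

Variant bp_gen := Bp_r | Bp_s | Bp_t.

Section BinaryPolyhedral.
Variables l m n : nat.
Let r := Gen Bp_r.
Let s := Gen Bp_s.
Let t := Gen Bp_t.
Variant bp_rel : gterm bp_gen -> gterm bp_gen -> Prop :=
  | Bp_rpow : bp_rel (r ^+ l) (r * s * t)
  | Bp_spow : bp_rel (s ^+ m) (r * s * t)
  | Bp_tpow : bp_rel (t ^+ n) (r * s * t).

(* Coxeter's binary polyhedral group <l,m,n>: r^l = s^m = t^n = rst. *)
Definition binary_polyhedral : Type := presented bp_rel.
HB.instance Definition _ := Group.on binary_polyhedral.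
End BinaryPolyhedral.

Definition binary_tetrahedral : groupType := binary_polyhedral 2 3 3.
Definition binary_octahedral : groupType := binary_polyhedral 2 3 4.

Variant K1_gen := K1_x | K1_y | K1_a | K1_b.

Section K1.
Let x := Gen K1_x.
Let y := Gen K1_y.
Let a := Gen K1_a.
Let b := Gen K1_b.
Variant K1_rel : gterm K1_gen -> gterm K1_gen -> Prop :=
  | K1_powx : K1_rel (x ^+ 4) (y ^+ 2)
  | K1_powa : K1_rel (a ^+ 4) (b ^+ 2)
  | K1_conjx : K1_rel (y * x * y^-1) x^-1
  | K1_conja : K1_rel (b * a * b^-1) a^-1
  | K1_glue2 : K1_rel (x ^+ 2) (a ^+ 2)
  | K1_glue1 : K1_rel y b.

Definition K1 : Type := presented K1_rel.
HB.instance Definition _ := Group.on K1.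
End K1.

Record add_action (G : groupType) (A : zmodType) := AddAction {
  add_act :> G -> A -> A;
  add_act1 : forall a, add_act 1 a = a;
  add_actM : forall g h a, add_act (g * h) a = add_act g (add_act h a);
  add_actD : forall g (a b : A),
    add_act g (a + b)%R = (add_act g a + add_act g b)%R }.

(* A ><| G for an additively written abelian group A: the product is
   (a, g) (b, h) = (a + g.b, g h), so that (0, g) (a, 1) (0, g)^-1 = (g.a, 1).
   The carrier ignores th; the group structure below is keyed on it. *)
Definition semidirect (G : groupType) (A : zmodType) (th : add_action G A)
  : Type := (A * G)%type.

Section Semidirect.
Variables (G : groupType) (A : zmodType) (th : add_action G A).
Local Notation semidirect := (semidirect th).

HB.instance Definition _ := Choice.on semidirect.

Definition sd_one : semidirect := (0%R, 1).
Definition sd_mul (u v : semidirect) : semidirect :=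
  ((u.1 + th u.2 v.1)%R, u.2 * v.2).
Definition sd_inv (u : semidirect) : semidirect :=
  ((- th u.2^-1%g u.1)%R, u.2^-1).

Lemma add_act0 g : th g 0%R = 0%R.
Proof. by apply: (GRing.addrI (th g 0%R)); rewrite -add_actD !GRing.addr0. Qed.

Lemma add_actN g a : th g (- a)%R = (- th g a)%R.
Proof.
by apply: (GRing.addrI (th g a)); rewrite -add_actD !GRing.addrN add_act0.
Qed.

Fact sd_mulA : associative sd_mul.
Proof.
by move=> u v w; rewrite /sd_mul /= add_actD add_actM GRing.addrA mulgA.
Qed.
Fact sd_mul1 : left_id sd_one sd_mul.
Proof. by case=> a g; rewrite /sd_mul /= add_act1 GRing.add0r mul1g. Qed.
Fact sd_mulg1 : right_id sd_one sd_mul.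
Proof. by case=> a g; rewrite /sd_mul /= add_act0 GRing.addr0 mulg1. Qed.
Fact sd_mulV : left_inverse sd_one sd_inv sd_mul.
Proof. by case=> a g; rewrite /sd_mul /= GRing.addNr mulVg. Qed.
Fact sd_mulgV : right_inverse sd_one sd_inv sd_mul.
Proof.
by case=> a g; rewrite /sd_mul /= add_actN -add_actM mulgV add_act1 GRing.addrN.
Qed.

HB.instance Definition _ := isGroup.Build semidirect
  sd_mulA sd_mul1 sd_mulg1 sd_mulV sd_mulgV.

Definition sd_inl (a : A) : semidirect := (a, 1).
Definition sd_inr (g : G) : semidirect := (0%R, g).

End Semidirect.

(* Main.v *)
Require Import Defs.
From HB Require Import structures.
From mathcomp Require Import all_boot all_order all_algebra all_fingroup cyclic.
Import GroupScope.
Local Open Scope group_scope.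

(** Write A and B for the two copies of G inside the amalgam. If the two
    embeddings of H coincide, with image N, then A and B agree on N, and for
    g outside N the element t = B(g) A(g)^-1 does not depend on g, because two
    such g differ by an element of N. It follows that A(g) commutes with t for
    g in N, while A(g) t A(g)^-1 = t^-1 for g outside N. Every element of the
    amalgam is therefore of the form t^k A(g). Folding A and B onto G, and
    recording in Z whether a letter of B lies outside N, gives a morphism to
    Z ><| G which sends t^k A(g) to (k, g), and so is an isomorphism
    ([double_semidirect], [amalgam_double]).

    For different embeddings i1, i2 it is enough that i2 = alpha o i1 for some
    automorphism alpha of G ([amalgam_of_extension]): the amalgam is then a
    double up to relabelling. To produce alpha, present G and describe the
    generators of H by words in the generators of G; alpha exists as soon as
    each embedding i extends to an epimorphism from the presented group to G
    which sends these words to the images under i ([amalgam_of_covers]). An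
    epimorphism from a group isomorphic to the finite group G is bijective.

    - G cyclic of order 4q: the generator of H has order 2q, and is the square
      of a generator of G.
    - G dicyclic, H cyclic: the image a of the generator of H, with a suitable
      b outside <a>, satisfies the dicyclic relations.
    - G dicyclic, H dicyclic of half the order, q >= 6: the element of order q
      in H must go into the cyclic part of G, because the elements outside
      have order 4; there it has a square root which generates the cyclic part.
    - G binary octahedral, H binary tetrahedral = <s, u>: there is y in G with
      y^2 = i(s) i(u) and y i(s) y^-1 = i(u), so that i(s) and y are
      octahedral generators. This is a finite verification in an explicit list
      of the 48 elements ([oct_pair_root], [tet_pair_extends]).

    For G = Q_16 and H = Q_8 the automorphism can fail to exist, as an
    automorphism of order 3 of Q_8 does not extend to Q_16. But the
    presentation of K_1 exhibits it as a double of Q_16 along the subgroup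
    generated by x^2 and y, and any subgroup of index 2 isomorphic to Q_8
    can play the role of this subgroup ([K1_sign_semidirect]).

    The presentations alone bound the groups from above. The lower bounds on
    orders come from regular permutation representations ([dic_order],
    [oct_ev_inj]). *)

Set Implicit Arguments.
Unset Strict Implicit.
Unset Printing Implicit Defensive.

(** * Morphisms and presented groups *)

Lemma bijective_of_inj_surj (A B : choiceType) (f : A -> B) :
  injective f -> (forall y, exists x, f x = y) -> bijective f.
Proof.
move=> f_inj f_surj.
have ex y : exists x, f x == y by have [x <-] := f_surj y; exists x.
exists (fun y => xchoose (ex y)) => [x|y]; last exact/eqP/(xchooseP (ex y)).
exact/f_inj/eqP/(xchooseP (ex (f x))).
Qed.

Lemma homM_exists (A B : groupType) (f : A -> B) :
  {morph f : x y / x * y} -> exists g : {multiplicative A -> B}, g =1 f.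
Proof.
move=> fM; pose m := isMultiplicative.Build A B f fM.
pose g : {multiplicative A -> B} := HB.pack f m.
by exists g.
Qed.

Section HomTheory.
Variables (A B : groupType) (f : {multiplicative A -> B}).

Lemma hom1 : f 1 = 1.
Proof. by apply: (@mulgI _ (f 1)); rewrite -gmulfM !mulg1. Qed.

Lemma homV : {morph f : x / x^-1}.
Proof. by move=> x; apply/divg1_eq; rewrite invgK -gmulfM mulVg hom1. Qed.

Lemma homX n : {morph f : x / x ^+ n}.
Proof.
by move=> x; elim: n => [|n IHn]; rewrite ?hom1 // !expgS gmulfM IHn.
Qed.

Lemma hom_inj : (forall x, f x = 1 -> x = 1) -> injective f.
Proof.
by move=> fI x y xy; apply/divg1_eq/fI; rewrite gmulfM homV xy mulgV.
Qed.

Lemma inverse_hom :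
  bijective f -> exists2 g : {multiplicative B -> A}, cancel f g & cancel g f.
Proof.
case=> g fK gK; have [g' g'E] := homM_exists (can2_gmulfM fK gK).
by exists g' => x; rewrite g'E.
Qed.

End HomTheory.

Lemma isomorphic_sym (A B : groupType) : isomorphic A B -> isomorphic B A.
Proof.
by case=> f /inverse_hom[g fK gK]; exists g, f.
Qed.

Lemma isomorphic_trans (A B C : groupType) :
  isomorphic A B -> isomorphic B C -> isomorphic A C.
Proof.
case=> f f_bij [g g_bij].
by exists (g \o f : {multiplicative A -> C}); apply: bij_comp.
Qed.

Section PresentedTheory.
Variables (X : Type) (R : gterm X -> gterm X -> Prop).

Fixpoint gterm_eval (Q : baseGroupType) (v : X -> Q) (u : gterm X) : Q :=
  match u with
  | Gen i => v i
  | GOne => 1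
  | GMul u w => gterm_eval v u * gterm_eval v w
  | GInv u => (gterm_eval v u)^-1
  end.

Lemma gterm_evalX (Q : groupType) (v : X -> Q) u n :
  gterm_eval v (u ^+ n) = gterm_eval v u ^+ n.
Proof. by elim: n => // -[|n] IHn //; rewrite !expgSS -IHn. Qed.

Lemma pclass_eval u : pclass R u = gterm_eval (pgen R) u.
Proof. by elim: u => //= [u <- w <-|u <-]; rewrite ?pclassM ?pclassV. Qed.

Lemma presented_rel u w :
  R u w -> gterm_eval (pgen R) u = gterm_eval (pgen R) w.
Proof. by move=> uw; rewrite -!pclass_eval; apply/pclassP/geq_rel. Qed.

(** The universal property of a presented group. It is stated as an existence
    because the properties on generators are all that is used afterwards. *)
Lemma presented_lift (Q : groupType) (v : X -> Q) :
  (forall u w, R u w -> gterm_eval v u = gterm_eval v w) ->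
  exists f : {multiplicative presented R -> Q}, forall i, f (pgen R i) = v i.
Proof.
move=> vR.
have evR u w : gterm_eq R u w -> gterm_eval v u = gterm_eval v w.
  elim=> {u w}//=.
  - by move=> u w x _ -> _ ->.
  - by move=> u u' w w' _ -> _ ->.
  - by move=> u w _ ->.
  - by move=> u w x; rewrite mulgA.
  - by move=> u; rewrite mul1g.
  - by move=> u; rewrite mulVg.
pose f (a : presented R) := gterm_eval v (generic_quotient.repr a).
have fE u : f (pclass R u) = gterm_eval v u by apply/evR/repr_pclass.
have fM : {morph f : x y / x * y}.
  move=> x y; rewrite -(pclass_repr x) -(pclass_repr y).
  have pM u w : pclass R u * pclass R w = pclass R (u * w) by rewrite pclassM.
  by rewrite pM !fE.
have [g gE] := homM_exists fM.
by exists g => i; rewrite gE; apply: fE.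
Qed.

Lemma presented_ind (Q : presented R -> Prop) :
  Q 1 -> (forall x y, Q x -> Q y -> Q (x * y)) -> (forall x, Q x -> Q x^-1) ->
  (forall i, Q (pgen R i)) -> forall x, Q x.
Proof.
move=> Q1 QM QV Qg x; rewrite -(pclass_repr x) pclass_eval.
by elim: (generic_quotient.repr x) => //= *; [apply: QM | apply: QV].
Qed.

(** The form of induction suited to normal forms: it only asks how a letter
    acts on the left of an element which is already in normal form. *)
Lemma presented_left_ind (Q : presented R -> Prop) :
  Q 1 -> (forall i x, Q x -> Q (pgen R i * x)) ->
  (forall i x, Q x -> Q ((pgen R i)^-1 * x)) -> forall x, Q x.
Proof.
move=> Q1 Qg QgV x.
pose S u := forall w, Q w -> Q (u * w) /\ Q (u^-1 * w).
suff Sx : S x by have [] := Sx 1 Q1; rewrite mulg1.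
elim/presented_ind: x => [|x y Sx Sy|x Sx|i] w Qw.
- by rewrite invg1 mul1g.
- rewrite invgM -!mulgA; have [/Sx[Qxy _] _] := Sy _ Qw.
  by have [_ /Sy[_ Qyx]] := Sx _ Qw.
- by have [] := Sx _ Qw; rewrite invgK.
- by split; [apply: Qg | apply: QgV].
Qed.
End PresentedTheory.

(** * The double of a group along a subgroup of index 2 *)

(** A subgroup of index 2 enters through the indicator c of its complement,
    which is a morphism to the additive group of booleans. *)
Section SignAction.
Variables (G : groupType) (c : G -> bool).
Hypothesis cM : {morph c : x y / x * y >-> x (+) y}.

Lemma char1 : c 1 = false.
Proof. by have := cM 1 1; rewrite mulg1; case: (c 1). Qed.

Lemma charV x : c x^-1 = c x.
Proof.
by have := cM x x^-1; rewrite mulgV char1; case: (c x) (c x^-1) => [] [].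
Qed.

Definition sign_act (g : G) (n : int) : int := if c g then (- n)%R else n.

Fact sign_act1 n : sign_act 1 n = n.
Proof. by rewrite /sign_act char1. Qed.

Lemma sign_act0 g : sign_act g 0%R = 0%R.
Proof. by rewrite /sign_act; case: (c g); rewrite ?GRing.oppr0. Qed.

Fact sign_actM g h n : sign_act (g * h) n = sign_act g (sign_act h n).
Proof.
by rewrite /sign_act cM; case: (c g) (c h) => [] []; rewrite ?GRing.opprK.
Qed.

Fact sign_actD g m n : sign_act g (m + n)%R = (sign_act g m + sign_act g n)%R.
Proof. by rewrite /sign_act; case: (c g); rewrite ?GRing.opprD. Qed.

Definition sign_action : add_action G int :=
  AddAction sign_act1 sign_actM sign_actD.

Local Notation ZG := (semidirect sign_action).

Lemma sdM (m n : int) (g h : G) :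
  ((m, g) : ZG) * ((n, h) : ZG) = ((m + sign_act g n)%R, g * h).
Proof. by []. Qed.

Lemma sdV (n : int) (g : G) : ((n, g) : ZG)^-1 = ((- sign_act g^-1 n)%R, g^-1).
Proof. by []. Qed.

Lemma sd_conj (k g : G) (n : int) :
  ((0%R, k) : ZG) * ((n, g) : ZG) * ((0%R, k) : ZG)^-1 =
  (sign_act k n, k * g * k^-1).
Proof.
congr (_, _) => /=.
by rewrite !(sign_act0, GRing.oppr0) GRing.addr0 GRing.add0r.
Qed.

Lemma sign_action_conj (g : G) (t := sd_inl sign_action 1%R) :
  sd_inr sign_action g * t * (sd_inr sign_action g)^-1 =
  if c g then t^-1 else t.
Proof.
rewrite /t /sd_inr /sd_inl sd_conj sdV mulg1 mulgV invg1 sign_act1 /sign_act.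
by case: (c g).
Qed.

(** Here c g0 holds and t = B g0 * (A g0)^-1. The normal form t^k A(g), with k
    of either sign, is stable under left multiplication by A(h) and B(h); as
    phi reads off k and g, it is injective. *)
Lemma double_semidirect (P : groupType) (A B : {multiplicative G -> P})
    (phi : {multiplicative P -> ZG}) (g0 : G) :
  c g0 -> (forall g, ~~ c g -> A g = B g) ->
  (forall Q : P -> Prop, Q 1 -> (forall g p, Q p -> Q (A g * p)) ->
     (forall g p, Q p -> Q (B g * p)) -> forall p, Q p) ->
  (forall g, phi (A g) = (0%R, g)) ->
  (forall g, phi (B g) = ((c g : nat) : int, g)) ->
  isomorphic P ZG.
Proof.
move=> cg0 AB gen phiA phiB; pose t := B g0 * (A g0)^-1.
have tE g : c g -> B g = t * A g.
  move=> cg; have /AB : ~~ c (g0^-1 * g) by rewrite cM charV cg0 cg.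
  rewrite !gmulfM !homV => e.
  by rewrite /t -mulgA e mulVKg.
have tA g : ~~ c g -> A g * t = t * A g.
  move=> cg; have cgg0 : c (g * g0) by rewrite cM (negPf cg) cg0.
  have := tE _ cgg0; rewrite !gmulfM -(AB _ cg) => e.
  by rewrite /t mulgA e !mulgA mulgK.
have tAV g : c g -> A g * t = t^-1 * A g.
  move=> cg; have /tE : c g^-1 by rewrite charV.
  rewrite !homV (tE _ cg) invgM => /(canRL (mulKg _)); rewrite invgK => e.
  by rewrite {1}e -!mulgA mulVg mulg1.
have nf p : exists n g, p = t ^+ n * A g \/ p = t ^- n * A g.
  have tS n g : exists m h, t * (t ^+ n * A g) = t ^+ m * A h \/
                            t * (t ^+ n * A g) = t ^- m * A h.
    by exists n.+1, g; left; rewrite mulgA -expgS.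
  have tSV n g : exists m h, t * (t ^- n * A g) = t ^+ m * A h \/
                             t * (t ^- n * A g) = t ^- m * A h.
    case: n => [|n]; first by rewrite invg1; apply: (tS 0).
    by exists n, g; right; rewrite mulgA expgSr invgM mulVKg.
  have Anf g n h : exists m k, A g * (t ^+ n * A h) = t ^+ m * A k \/
                     A g * (t ^+ n * A h) = t ^- m * A k.
    exists n, (g * h); rewrite gmulfM !mulgA.
    case: (boolP (c g)) => cg; [right|left].
      congr (_ * _); rewrite -expVgn; elim: n => [|n IHn].
        by rewrite mulg1 mul1g.
      by rewrite !expgSr mulgA IHn -mulgA (tAV _ cg) mulgA.
    by congr (_ * _); apply/commuteX/tA.
  have AnfV g n h : exists m k, A g * (t ^- n * A h) = t ^+ m * A k \/
                     A g * (t ^- n * A h) = t ^- m * A k.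
    exists n, (g * h); rewrite gmulfM !mulgA.
    case: (boolP (c g)) => cg; [left|right].
      congr (_ * _); rewrite -expVgn; elim: n => [|n IHn].
        by rewrite mulg1 mul1g.
      have -> : A g * t^-1 ^+ n.+1 = t ^+ n * (A g * t^-1).
        by rewrite expgSr mulgA IHn mulgA.
      have -> : A g * t^-1 = t * A g.
        by apply: (canLR (mulgK _)); rewrite -mulgA (tAV _ cg) mulVKg.
      by rewrite mulgA expgSr.
    by congr (_ * _); apply/commuteV/commuteX/tA.
  elim/gen: p => [|g p [n [h [|]]] ->|g p]; [|exact: Anf|exact: AnfV|].
    by exists 0, 1; left; rewrite hom1 mulg1.
  move=> [n [h nh]].
  have [m [k mk]] : exists m k, A g * p = t ^+ m * A k \/
                                A g * p = t ^- m * A k.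
    by case: nh => ->; [exact: Anf|exact: AnfV].
  case: (boolP (c g)) => cg; last by rewrite -(AB _ cg); exists m, k.
  by rewrite (tE _ cg) -mulgA; case: mk => ->; [exact: tS | exact: tSV].
have phit1 : phi t = (1%R, 1).
  rewrite /t gmulfM homV phiA phiB cg0 sdV !sdM /sign_act charV cg0 mulgV.
  by rewrite !GRing.oppr0.
have phit n : phi (t ^+ n) = (n%:Z%R, 1).
  elim: n => [|n IHn]; first by rewrite hom1.
  by rewrite expgSr gmulfM IHn phit1 sdM sign_act1 mulg1 -addn1 PoszD.
have phitV n : phi (t ^- n) = ((- n%:Z)%R, 1).
  by rewrite homV phit sdV invg1 sign_act1.
exists phi; apply: bijective_of_inj_surj.
  apply: hom_inj => p; have [n [g [] ->]] := nf p;
    rewrite gmulfM phiA ?phit ?phitV.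
    by rewrite sdM mul1g sign_act1 GRing.addr0 => -[-> ->]; rewrite hom1 mulg1.
  rewrite sdM mul1g sign_act1 GRing.addr0 => -[/eqP].
  by rewrite GRing.oppr_eq0 => /eqP[->] ->; rewrite hom1 mulg1 invg1.
case=> [[n|n] g].
  exists (t ^+ n * A g); rewrite gmulfM phit phiA sdM sign_act1 GRing.addr0.
  by rewrite mul1g.
exists (t ^- n.+1 * A g); rewrite gmulfM phitV phiA sdM sign_act1 GRing.addr0.
by rewrite mul1g.
Qed.
End SignAction.

(** After the automorphisms b1 and b2 are undone, f and g both become iota, and
    the amalgam is generated by two copies of G which agree on the image of
    iota. *)
Lemma amalgam_double (K G : groupType) (f g iota : K -> G)
    (b1 b2 : {multiplicative G -> G}) (c : G -> bool)
    (cM : {morph c : x y / x * y >-> x (+) y}) (g0 : G) :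
  bijective b1 -> bijective b2 -> b1 \o iota =1 f -> b2 \o iota =1 g ->
  c g0 -> (forall x, reflect (exists k, iota k = x) (~~ c x)) ->
  isomorphic (amalgam f g) (semidirect (sign_action cM)).
Proof.
move=> /inverse_hom[b1' b1K b1'K] /inverse_hom[b2' b2K b2'K] b1f b2g cg0 cP.
pose R := amalgam_rel f g.
have [inlA inlE] : exists A : {multiplicative G -> presented R},
    A =1 fun a => pgen R (inl a).
  by apply: homM_exists => x y; have := presented_rel (amalgam_mull f g x y).
have [inrB inrE] : exists B : {multiplicative G -> presented R},
    B =1 fun b => pgen R (inr b).
  by apply: homM_exists => x y; have := presented_rel (amalgam_mulr f g x y).
pose v (i : G + G) : semidirect (sign_action cM) :=
  match i with
  | inl a => (0%R, b1' a)
  | inr b => ((c (b2' b) : nat) : int, b2' b)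
  end.
have [phi phiE] : exists phi : {multiplicative presented R ->
    semidirect (sign_action cM)}, forall i, phi (pgen R i) = v i.
  apply: presented_lift => u w [x y|x y|k] /=.
  - by rewrite sdM gmulfM sign_act0 GRing.addr0.
  - by rewrite sdM gmulfM cM /sign_act; case: (c (b2' x)) (c (b2' y)) => [] [].
  - rewrite -b1f -b2g /= b1K b2K; suff /negPf-> : ~~ c (iota k) by [].
    by apply/cP; exists k.
pose A : {multiplicative G -> presented R} := inlA \o b1.
pose B : {multiplicative G -> presented R} := inrB \o b2.
apply: (double_semidirect (A := A) (B := B) (phi := phi) cg0).
- move=> x /cP[k <-]; rewrite /A /B /= inlE inrE.
  by have := presented_rel (amalgam_glue f g k); rewrite -b1f -b2g.
- move=> Q Q1 QA QB p.
  have Qinl a p' : Q p' -> Q (pgen R (inl a) * p').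
    by move/(QA (b1' a)); rewrite /A /= inlE b1'K.
  have Qinr b p' : Q p' -> Q (pgen R (inr b) * p').
    by move/(QB (b2' b)); rewrite /B /= inrE b2'K.
  elim/presented_left_ind: p => [//|[a|b] p' Qp'|[a|b] p' Qp'].
  + exact: Qinl.
  + exact: Qinr.
  + by rewrite -inlE -homV inlE; apply: Qinl.
  + by rewrite -inrE -homV inrE; apply: Qinr.
- by move=> x; rewrite /A /= inlE phiE /= b1K.
- by move=> x; rewrite /B /= inrE phiE /= b2K.
Qed.

(** Two elements outside a subgroup of index 2 lie in the same coset. *)
Lemma notin_index2M (G : finGroupType) (K : {group G}) :
  #|[set: G] : K| = 2 ->
  {morph (fun x => x \notin K) : x y / x * y >-> x (+) y}.
Proof.
move=> iK x y; have KG : K \subset [set: G] by apply: subsetT.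
case: (boolP (x \in K)) => /= [xK|xK]; first by rewrite groupMl.
case: (boolP (y \in K)) => /= [yK|yK]; first by rewrite groupMr // xK.
have yV : y^-1 \in [set: G] :\: K by rewrite !inE groupV yK.
have : x \in K :* y^-1 by rewrite (rcoset_index2 KG iK yV) !inE xK.
by rewrite mem_rcoset invgK => ->.
Qed.

Definition sign_semidirect (P : groupType) (G : finGroupType) (N : {set G}) :=
  exists th : add_action G int,
    (forall g : G,
       let t := sd_inl th 1%R in
       sd_inr th g * t * (sd_inr th g)^-1 = if g \in N then t else t^-1)
    /\ isomorphic P (semidirect th).

Lemma sign_semidirect_char (P : groupType) (G : finGroupType) (N : {set G})
    (cM : {morph (fun x => x \notin N) : x y / x * y >-> x (+) y}) :
  isomorphic P (semidirect (sign_action cM)) -> sign_semidirect P N.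
Proof.
move=> iso; exists (sign_action cM); split=> // g t.
by rewrite sign_action_conj; case: (g \in N).
Qed.

Lemma index2_compl (G : finGroupType) (K : {group G}) :
  #|[set: G] : K| = 2 -> exists g0, g0 \notin K.
Proof.
move=> iK; have : ~~ ([set: G] \subset K) by rewrite -indexg_gt1 iK.
by case/subsetPn => g _; exists g.
Qed.

(** Either copy of G can be taken as the reference one: N = i1(H) uses alpha on
    the second copy, and N = i2(H) uses its inverse on the first. *)
Lemma amalgam_of_extension (G H : finGroupType)
    (i1 i2 : {morphism [set: H] >-> G})
    (index1 : #|[set: G] : i1 @* [set: H]| = 2)
    (index2 : #|[set: G] : i2 @* [set: H]| = 2)
    (alpha : {multiplicative G -> G}) :
  bijective alpha -> (forall h, alpha (i1 h) = i2 h) ->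
  forall N : {set G}, N = i1 @* [set: H] \/ N = i2 @* [set: H] ->
  sign_semidirect (amalgam i1 i2) N.
Proof.
move=> alpha_bij alphaE N.
have memP (i : {morphism [set: H] >-> G}) x :
    reflect (exists k, i k = x) (~~ (x \notin i @* [set: H])).
  rewrite negbK; apply: (iffP idP) => [/morphimP[k _ _ ->]|[k <-]].
    by exists k.
  by rewrite mem_morphim ?inE.
have id_bij : bijective (idfun : {multiplicative G -> G}) by exists id.
case=> ->.
  have [g0 g0N] := index2_compl index1.
  apply: (sign_semidirect_char (cM := notin_index2M index1)).
  exact: (amalgam_double _ id_bij alpha_bij (iota := i1) _ _ g0N).
have [beta alphaK betaK] := inverse_hom alpha_bij.
have beta_bij : bijective beta by exists alpha.
have [g0 g0N] := index2_compl index2.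
apply: (sign_semidirect_char (cM := notin_index2M index2)).
apply: (amalgam_double _ beta_bij id_bij (iota := i2) _ _ g0N) => // h /=.
by rewrite -alphaE alphaK.
Qed.

(** * Extending the identification of the two subgroups *)

(** P is as large as G, so that a surjection is a bijection by finiteness. *)
Lemma hom_surj_bij (P : groupType) (G : finGroupType)
    (p : {multiplicative P -> G}) :
  isomorphic G P -> (forall y, exists w, p w = y) -> bijective p.
Proof.
case=> e [e' eK e'K] p_surj.
have pe_surj : forall y, exists x, (p \o e) x = y.
  by move=> y; have [w <-] := p_surj y; exists (e' w); rewrite /= e'K.
have pe_inj : injective (p \o e).
  suff /image_injP inj : #|image (p \o e) G| == #|G|.
    by move=> x y; apply: inj.
  rewrite (eq_card (B := G)) // => y; apply/imageP.
  by have [x <-] := pe_surj y; exists x.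
apply: bijective_of_inj_surj => // x y.
by rewrite -{1}(e'K x) -{1}(e'K y) => /pe_inj; apply: (can_inj e'K).
Qed.

Lemma surj_on_gens (X : Type) (R : gterm X -> gterm X -> Prop) (G : groupType)
    (e p : {multiplicative presented R -> G}) :
  bijective e -> (forall i, exists w, p w = e (pgen R i)) ->
  forall y, exists w, p w = y.
Proof.
case=> e' _ e'K gens y; rewrite -(e'K y).
elim/presented_ind: (e' y) => [|x z [w1 e1] [w2 e2]|x [w1 e1]|//].
- by exists 1; rewrite !hom1.
- by exists (w1 * w2); rewrite !gmulfM e1 e2.
- by exists w1^-1; rewrite !homV e1.
Qed.

Section Covers.
Variables (P : groupType) (G H : finGroupType).
Variables (i1 i2 : {morphism [set: H] >-> G}) (p1 p2 : {multiplicative P -> G}).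

Definition covered (h : H) : Prop := exists w, p1 w = i1 h /\ p2 w = i2 h.

Lemma covered1 : covered 1.
Proof. by exists 1; rewrite !hom1 !morph1. Qed.

Lemma coveredM x y : covered x -> covered y -> covered (x * y).
Proof.
case=> [u [u1 u2]] [w [w1 w2]]; exists (u * w).
by rewrite !gmulfM !morphM ?inE // u1 u2 w1 w2.
Qed.

Lemma coveredV x : covered x -> covered x^-1.
Proof.
by case=> [u [u1 u2]]; exists u^-1; rewrite !homV !morphV ?inE // u1 u2.
Qed.

Lemma coveredX x n : covered x -> covered (x ^+ n).
Proof.
move=> cx; elim: n => [|n IHn]; first exact: covered1.
by rewrite expgS; apply: coveredM.
Qed.

Lemma covered_gens (X : Type) (R : gterm X -> gterm X -> Prop)
    (e : {multiplicative presented R -> H}) :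
  bijective e -> (forall i, covered (e (pgen R i))) -> forall h, covered h.
Proof.
case=> e' _ e'K gens h; rewrite -(e'K h).
elim/presented_ind: (e' h) => [|x z|x|//]; rewrite ?hom1 ?gmulfM ?homV.
- exact: covered1.
- exact: coveredM.
- exact: coveredV.
Qed.

(** The automorphism p2 o p1^-1 of G carries i1 to i2. *)
Lemma amalgam_of_covers (index1 : #|[set: G] : i1 @* [set: H]| = 2)
    (index2 : #|[set: G] : i2 @* [set: H]| = 2) :
  isomorphic G P ->
  (forall y, exists w, p1 w = y) -> (forall y, exists w, p2 w = y) ->
  (forall h, covered h) ->
  forall N : {set G}, N = i1 @* [set: H] \/ N = i2 @* [set: H] ->
  sign_semidirect (amalgam i1 i2) N.
Proof.
move=> iso /(hom_surj_bij iso) p1_bij /(hom_surj_bij iso) p2_bij cov.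
have [p1' p1K p1'K] := inverse_hom p1_bij.
apply: (@amalgam_of_extension _ _ _ _ index1 index2 (p2 \o p1')) => [|h].
  by apply: bij_comp => //; exists p1.
by have [w [<- <-]] := cov h; rewrite /= p1K.
Qed.
End Covers.

(** * Dicyclic groups *)

Definition dic_gens (Q : groupType) (m : nat) (x y : Q) :=
  x ^+ m = y ^+ 2 /\ y * x * y^-1 = x^-1.

Section DicyclicRelations.
Variables (Q : groupType) (m : nat) (x y : Q).
Hypothesis xy : dic_gens m x y.

Lemma dic_conjX i : y * x ^+ i * y^-1 = x ^- i.
Proof.
have -> : y * x ^+ i * y^-1 = (x ^+ i) ^ y^-1 by rewrite conjgE invgK mulgA.
by rewrite conjXg conjgE invgK mulgA xy.2 expVgn.
Qed.

Lemma dic_conj_nf k i : x ^+ k * y * x ^+ i * (x ^+ k * y)^-1 = x ^- i.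
Proof.
have -> : x ^+ k * y * x ^+ i * (x ^+ k * y)^-1 =
          x ^+ k * (y * x ^+ i * y^-1) * x ^- k by rewrite invgM !mulgA.
rewrite dic_conjX; apply: (canLR (mulgK _)).
by apply/esym/commute_sym/commuteV/commuteX2.
Qed.

(** Conjugation by y inverts x^m, but also fixes it since x^m = y^2. *)
Lemma dic_X2m : x ^+ (2 * m) = 1.
Proof.
have := dic_conjX m; rewrite xy.1 -expgS expgSr mulgK -xy.1 => e.
by rewrite mul2n -addnn expgnDr {1}e mulVg.
Qed.

Lemma dic_sqr i : (x ^+ i * y) ^+ 2 = y ^+ 2.
Proof.
rewrite !expg2 !mulgA -[_ * y * x ^+ i]mulgA -{1}(mulgVK y (y * x ^+ i)).
by rewrite dic_conjX mulgA mulgV mul1g.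
Qed.

Lemma dic_exp4 i : (x ^+ i * y) ^+ 4 = 1.
Proof. by rewrite (expgnA _ 2 2) dic_sqr -xy.1 -expgnA mulnC dic_X2m. Qed.

Lemma dic_lift : exists f : {multiplicative dicyclic m -> Q},
  f (pgen (dic_rel m) Dic_x) = x /\ f (pgen (dic_rel m) Dic_y) = y.
Proof.
have [|f fE] := @presented_lift _ (dic_rel m) Q
    (fun g => match g with Dic_x => x | Dic_y => y end).
  by move=> u w [] /=; rewrite ?gterm_evalX /=; case: xy.
by exists f; rewrite !fE.
Qed.
End DicyclicRelations.

Lemma dic_pgen m : dic_gens m (pgen (dic_rel m) Dic_x) (pgen (dic_rel m) Dic_y).
Proof.
split; last exact: (presented_rel (Dic_conj m)).
by have := presented_rel (Dic_pow m); rewrite !gterm_evalX.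
Qed.

(** The relations give x^(2m) = 1; that x has no smaller order is seen on the
    action by right multiplication on the normal forms x^i y^j, where (i, j)
    with i mod 2m and j boolean stands for x^i y^j. *)
Section DicyclicRegular.
Variable m : nat.
Hypothesis m_gt0 : (0 < m)%N.
Local Notation point := ('Z_(2 * m) * bool)%type.

Definition reg_x (p : point) : point :=
  if p.2 then ((p.1 - 1)%R, true) else ((p.1 + 1)%R, false).
Definition reg_y (p : point) : point :=
  if p.2 then ((p.1 + m%:R)%R, false) else (p.1, true).

Fact m2_gt1 : (1 < 2 * m)%N.
Proof. by case: m m_gt0 => // n _; rewrite mulnS. Qed.

Fact m2_eq0 : (m%:R + m%:R = 0 :> 'Z_(2 * m))%R.
Proof. by rewrite -GRing.natrD addnn -mul2n pchar_Zp // m2_gt1. Qed.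

Fact reg_x_inj : injective reg_x.
Proof.
move=> [i a] [j b] e.
have ab : a = b by move/(congr1 snd): e; case: (a) (b) => [] [].
rewrite -ab in e *; congr (_, _); move: e => /(congr1 fst); rewrite /reg_x.
by case: (a) => /= /GRing.addIr.
Qed.

Fact reg_y_inj : injective reg_y.
Proof.
move=> [i a] [j b] e.
have ab : a = b by move/(congr1 snd): e; case: (a) (b) => [] [].
rewrite -ab in e *; congr (_, _); move: e => /(congr1 fst); rewrite /reg_y.
by case: (a) => //= /GRing.addIr. Qed.

Let X := perm reg_x_inj.
Let Y := perm reg_y_inj.

Fact reg_xX k (p : point) :
  (X ^+ k) p = if p.2 then ((p.1 - k%:R)%R, true) else ((p.1 + k%:R)%R, false).
Proof.
elim: k p => [|k IHk] p.
  by rewrite perm1; case: p => i [] /=; rewrite ?GRing.subr0 ?GRing.addr0.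
rewrite expgS permM IHk permE /reg_x; case: p => i [] /=.
  by rewrite GRing.mulrS GRing.opprD GRing.addrA.
by rewrite GRing.mulrS GRing.addrA.
Qed.

Fact reg_dic_gens : dic_gens m X Y.
Proof.
split.
  apply/permP => -[i e]; rewrite reg_xX expg2 permM !permE /reg_y.
  case: e => //=; congr (_, _); congr (_ + _)%R; apply/eqP.
  by rewrite eq_sym -GRing.addr_eq0 m2_eq0.
apply: (canLR (mulgK _)); apply: (canRL (mulKg _)); apply/permP => -[i e].
rewrite !permM !permE /reg_x /reg_y; case: e => //=; congr (_, _).
  by rewrite GRing.addrAC GRing.addrNK.
by rewrite GRing.addrK.
Qed.

Lemma dic_order k : pgen (dic_rel m) Dic_x ^+ k = 1 -> (2 * m %| k)%N.
Proof.
have [f [fx _]] := dic_lift reg_dic_gens.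
move/(congr1 f); rewrite homX fx hom1 => /permP/(_ (0%R, false)).
rewrite reg_xX perm1 /= GRing.add0r => -[] /(congr1 val) /=.
by rewrite val_Zp_nat ?m2_gt1 // => /eqP.
Qed.
End DicyclicRegular.

Section FiniteDicyclic.
Variables (m : nat) (G : finGroupType) (e : {multiplicative dicyclic m -> G}).
Hypotheses (m_gt0 : (0 < m)%N) (e_bij : bijective e).
Let x := e (pgen (dic_rel m) Dic_x).
Let y := e (pgen (dic_rel m) Dic_y).

Lemma fdic_gens : dic_gens m x y.
Proof.
have [r1 r2] := dic_pgen m; split; first by rewrite -!homX r1.
by rewrite -homV -!gmulfM r2 homV.
Qed.

Lemma fdic_order : #[x] = (2 * m)%N.
Proof.
apply/eqP; rewrite eqn_dvd order_dvdn (dic_X2m fdic_gens) eqxx /=.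
apply: (dic_order m_gt0); have := expg_order x.
by rewrite -homX -(hom1 e) => /(bij_inj e_bij).
Qed.

Lemma fdic_nf g : exists i, g = x ^+ i \/ g = x ^+ i * y.
Proof.
have fM u g' : (exists i, g' = x ^+ i \/ g' = x ^+ i * y) -> 
     exists i, e u * g' = x ^+ i \/ e u * g' = x ^+ i * y.
  elim/presented_ind: u g' => [|u w IHu IHw|u IHu|[]] g'.
  - by rewrite hom1 mul1g.
  - by rewrite gmulfM -mulgA => ?; apply/IHu/IHw.
  - rewrite homV => nfg; rewrite invg_expg.
    by elim: (_.-1) => [|n IHn]; rewrite ?mul1g // expgS -mulgA; apply: IHu.
  - by move=> [i [] ->]; exists i.+1; rewrite ?mulgA -expgS; [left | right].
  - have r := fdic_gens.
    have yx i : y * x ^+ i = x ^- i * y by rewrite -(dic_conjX r) mulgVK.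
    have xV i : x ^- i = x ^+ (i * (#[x]).-1).
      by rewrite mulnC expgnA -invg_expg expVgn.
    move=> [i [] ->]; rewrite -/y ?mulgA yx xV; first by eexists; right.
    by rewrite -mulgA -expg2 -r.1 -expgnDr; eexists; left.
case: e_bij => e' _ e'K; rewrite -(e'K g) -[e _]mulg1; apply: fM.
by exists 0; left.
Qed.
End FiniteDicyclic.

(** * Cyclic and dicyclic groups: the automorphism *)

Lemma isomorphic_Zp (G : finGroupType) n : (1 < n)%N -> isomorphic G 'Z_n ->
  exists2 g : G, #[g] = n & forall x, exists k, x = g ^+ k.
Proof.
move=> n_gt1 /isomorphic_sym[f f_bij].
have gen x : exists k, x = f Zp1 ^+ k.
  case: f_bij => f' _ f'K; rewrite -(f'K x); exists (f' x : nat).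
  by rewrite -homX Zp1_expgz.
exists (f Zp1) => //; rewrite -[RHS](card_ord n) -[in RHS](Zp_cast n_gt1).
rewrite orderE (bij_eq_card f_bij); apply: eq_card => x; rewrite !inE.
by have [k ->] := gen x; apply: mem_cycle.
Qed.

(** If a = x^i has order 2q then gcd(4q, i) = 2, so l = i / 2 is prime to 2q,
    hence to 4q: the square root x^l generates the same group as x. *)
Lemma cycle_sqrt (G : finGroupType) (x a : G) q : (0 < q)%N ->
  #[x] = (4 * q)%N -> #[a] = (2 * q)%N -> a \in <[x]> ->
  exists l, [/\ odd l, a = x ^+ l ^+ 2 & x \in <[x ^+ l]>].
Proof.
move=> q_gt0 ox oa /cycleP[i def_a].
have : (2 * gcdn (4 * q) i = 4)%N.
  have := orderXgcd x i; rewrite -def_a oa ox => e.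
  have d := dvdn_gcdl (4 * q) i; move: (divnK d); rewrite -e => /eqP.
  by rewrite mulnAC eqn_pmul2r // => /eqP.
move=> e4; have e2 : gcdn (4 * q) i = 2.
  by apply/eqP; rewrite -(eqn_pmul2l (isT : 0 < 2)%N) e4.
have /dvdnP[l def_i] : (2 %| i)%N by rewrite -e2 dvdn_gcdr.
have col : coprime (2 * q) l.
  move: e2; rewrite def_i (_ : 4 * q = 2 * q * 2)%N; last by rewrite mulnAC.
  by rewrite -muln_gcdl => /eqP; rewrite -[X in _ == X]mul1n eqn_pmul2r.
move: (col); rewrite coprimeMl coprime2n => /andP[l_odd coq].
exists l; split=> //; first by rewrite def_a def_i expgnA.
have : generator <[x]> (x ^+ l).
  rewrite generator_coprime ox -[4]/(2 * 2)%N -mulnA coprimeMl coprime2n.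
  by rewrite l_odd.
by move/eqP <-; apply: cycle_id.
Qed.

Lemma expg_odd (Q : groupType) (z : Q) k : z ^+ 2 = 1 -> odd k -> z ^+ k = z.
Proof.
move=> z2 k_odd; rewrite -(odd_double_half k) k_odd -mul2n expgnDr expgnA z2.
by rewrite expg1n mulg1.
Qed.

Lemma dic_surj m (G : finGroupType) (e p : {multiplicative dicyclic m -> G}) :
  bijective e ->
  (exists w, p w = e (pgen (dic_rel m) Dic_x)) ->
  (exists w, p w = e (pgen (dic_rel m) Dic_y)) -> forall y, exists w, p w = y.
Proof. by move=> e_bij px py; apply: (surj_on_gens e_bij) => -[]. Qed.

Section Cases.
Variables (q : nat) (G H : finGroupType) (i1 i2 : {morphism [set: H] >-> G}).
Hypotheses (inj1 : 'injm i1) (inj2 : 'injm i2).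
Hypothesis index1 : #|[set: G] : i1 @* [set: H]| = 2.
Hypothesis index2 : #|[set: G] : i2 @* [set: H]| = 2.
Variable N : {set G}.
Hypothesis hN : N = i1 @* [set: H] \/ N = i2 @* [set: H].

(** The generator h of H goes to the square of a generator of G, so the word
    that covers it is twice the generator of Z_4q. *)
Lemma case_cyclic : (1 <= q)%N -> isomorphic G 'Z_(4 * q) ->
  isomorphic H 'Z_(2 * q) -> sign_semidirect (amalgam i1 i2) N.
Proof.
move=> q_gt0 isoG isoH.
have n_gt1 : (1 < 4 * q)%N by case: (q) q_gt0 => // n _; rewrite mulnS.
have m_gt1 : (1 < 2 * q)%N by case: (q) q_gt0 => // n _; rewrite mulnS.
have [g og gG] := isomorphic_Zp n_gt1 isoG.
have [h oh hH] := isomorphic_Zp m_gt1 isoH.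
have cover (i : {morphism [set: H] >-> G}) : 'injm i -> 
  exists2 p : {multiplicative 'Z_(4 * q) -> G},
    (forall y, exists w, p w = y) & p (Zp1 ^+ 2) = i h.
  move=> inj; have oi : #[i h] = (2 * q)%N by rewrite order_injm ?inE.
  have ih_g : i h \in <[g]> by have [k ->] := gG (i h); apply: mem_cycle.
  have [l [l_odd def_ih gl]] := cycle_sqrt q_gt0 og oi ih_g.
  have oc : (Zp_trunc (4 * q)).+2 = (4 * q)%N by apply: Zp_cast.
  have cmod k : g ^+ l ^+ (k %% (Zp_trunc (4 * q)).+2) = g ^+ l ^+ k.
    rewrite oc [in RHS](divn_eq k (4 * q)) expgnDr (mulnC (k %/ _)).
    rewrite [g ^+ l ^+ (_ * _)]expgnA (expgnAC g l (4 * q)).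
    by rewrite -[in g ^+ (4 * q)]og expg_order !expg1n mul1g.
  have [|p pE] := @homM_exists 'Z_(4 * q) G (fun w => g ^+ l ^+ (w : nat)).
    by move=> x y; rewrite -expgnDr; apply: cmod.
  exists p => [y|].
    have [k ->] := gG y; have /cycleP[j def_g] := gl.
    by exists (Zp1 ^+ (j * k)); rewrite homX pE /= expg1 expgnA -def_g.
  by rewrite homX pE /= expg1.
have [p1 surj1 p1h] := cover _ inj1.
have [p2 surj2 p2h] := cover _ inj2.
apply: (amalgam_of_covers index1 index2 isoG surj1 surj2) => // x.
by have [k ->] := hH x; apply: coveredX; exists (Zp1 ^+ 2).
Qed.

(** The image of the generator of H takes the role of x. If it lies in <x>, it
    generates <x> and y can be kept. Otherwise G is the quaternion group, where
    all elements of order 4 play symmetric roles. *)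
Lemma case_dicyclic_cyclic : (2 <= q)%N -> isomorphic G (dicyclic q) ->
  isomorphic H 'Z_(2 * q) -> sign_semidirect (amalgam i1 i2) N.
Proof.
move=> q_gt1 isoG isoH; have q_gt0 := ltnW q_gt1.
have m_gt1 : (1 < 2 * q)%N by case: (q) q_gt0 => // n _; rewrite mulnS.
have [e e_bij] := isomorphic_sym isoG.
have [h oh hH] := isomorphic_Zp m_gt1 isoH.
set gx := pgen (dic_rel q) Dic_x; set gy := pgen (dic_rel q) Dic_y.
have [] := fdic_gens e; set x := e gx; set y := e gy => xqy yxy.
have ox : #[x] = (2 * q)%N := fdic_order q_gt0 e_bij.
have cover (i : {morphism [set: H] >-> G}) : 'injm i ->
  exists2 p : {multiplicative dicyclic q -> G},
    (forall y, exists w, p w = y) & p gx = i h.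
  move=> inj; have oi : #[i h] = (2 * q)%N by rewrite order_injm ?inE.
  have [k [def_ih|def_ih]] := fdic_nf e_bij (i h).
    have co : coprime (2 * q) k.
      have := orderXgcd x k; rewrite -def_ih oi ox => d.
      have d' := dvdn_gcdl (2 * q) k; move: (divnK d'); rewrite -d => /eqP.
      by rewrite -[X in _ == X]muln1 eqn_pmul2l // muln_gt0.
    have k_odd : odd k by move: co; rewrite coprimeMl coprime2n => /andP[].
    have [|p [px py]] := @dic_lift G q (i h) y.
      split; rewrite def_ih; last exact: (dic_conjX (conj xqy yxy)).
      rewrite expgnAC (@expg_odd _ (x ^+ q) k) //; rewrite -expgnA mulnC.
      exact: (dic_X2m (conj xqy yxy)).
    exists p => //; apply: (dic_surj e_bij); last by exists gy.
    have : generator <[x]> (x ^+ k) by rewrite generator_coprime ox.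
    move/eqP => gen; have : x \in <[x ^+ k]> by rewrite -gen cycle_id.
    case/cycleP => j def_x; exists (gx ^+ j).
    by rewrite homX px def_ih -/x -def_x.
  (* The order 2q of x^k y divides 4: G is Q_8, and x replaces y outside. *)
  have q2 : q = 2.
    have := dic_exp4 (conj xqy yxy) k; rewrite -def_ih => /eqP.
    rewrite -order_dvdn oi => /dvdn_leq.
    case: (q) q_gt1 => [|[|[|n]]] // _ /(_ isT); by rewrite !mulnS.
  have zq (z : G) : z ^+ q = z ^+ 2 by congr (z ^+ _).
  have [|p [px py]] := @dic_lift G q (i h) x.
    split; rewrite def_ih.
      by rewrite zq (dic_sqr (conj xqy yxy)) -xqy zq.
    apply: (canLR (mulgK _)); apply: (canRL (mulKg _)).
    have e1 : y * x ^+ k.+1 = x ^- k.+1 * y.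
      by rewrite -(dic_conjX (conj xqy yxy)) mulgVK.
    rewrite (mulgA x) -expgS -mulgA (mulgA y) e1 -mulgA -expg2 -xqy zq.
    by rewrite expgS invgM expg2 -!mulgA mulKg mulVKg.
  exists p => //; apply: (dic_surj e_bij); first by exists gy.
  by exists (gy ^- k * gx); rewrite gmulfM homV homX px py def_ih mulKg.
have [p1 surj1 p1h] := cover _ inj1.
have [p2 surj2 p2h] := cover _ inj2.
apply: (amalgam_of_covers index1 index2 isoG surj1 surj2) => // z.
by have [k ->] := hH z; apply: coveredX; exists gx.
Qed.

(** With u, v the generators of H and m = q / 2 >= 3: i(u) has order 2m > 4, so
    it lies in <x>; i(v) inverts i(u), whose order exceeds 2, so i(v) does not.
    A square root of i(u) in <x> and i(v) are dicyclic generators of G. *)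
Lemma case_dicyclic_dicyclic : (6 <= q)%N -> ~~ odd q ->
  isomorphic G (dicyclic q) -> isomorphic H (dicyclic q./2) ->
  sign_semidirect (amalgam i1 i2) N.
Proof.
move=> q_ge6 q_even isoG isoH; set m := q./2.
have qE : q = (2 * m)%N.
  by rewrite -[LHS](odd_double_half q) (negPf q_even) mul2n.
have m_ge3 : (3 <= m)%N by rewrite -(leq_pmul2l (isT : 0 < 2)%N) -qE.
have m_gt0 : (0 < m)%N by apply: leq_trans m_ge3.
have q_gt0 : (0 < q)%N by apply: leq_trans q_ge6.
have [e e_bij] := isomorphic_sym isoG.
have [e' e'_bij] := isomorphic_sym isoH.
set gx := pgen (dic_rel q) Dic_x; set gy := pgen (dic_rel q) Dic_y.
have xy := fdic_gens e; move: (xy) => [].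
set x := e gx in xy *; set y := e gy in xy * => xqy yxy.
have ox : #[x] = (4 * m)%N by rewrite (fdic_order q_gt0 e_bij) qE mulnA.
have uv := fdic_gens e'; move: (uv) => [].
set u := e' _ in uv *; set v := e' _ in uv * => umv vuv.
have ou : #[u] = (2 * m)%N := fdic_order m_gt0 e'_bij.
have cover (i : {morphism [set: H] >-> G}) : 'injm i ->
  exists p : {multiplicative dicyclic q -> G},
    [/\ (forall y, exists w, p w = y), p (gx ^+ 2) = i u & p gy = i v].
  move=> inj; have oi : #[i u] = (2 * m)%N by rewrite order_injm ?inE.
  have [k [def_iu|def_iu]] := fdic_nf e_bij (i u); last first.
    have := dic_exp4 xy k; rewrite -def_iu => /eqP.
    rewrite -order_dvdn oi => /dvdn_leq => /(_ isT).
    rewrite leqNgt => /negP[]; apply: (@leq_trans (2 * 3)) => //.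
    by rewrite leq_pmul2l.
  have iu_x : i u \in <[x]> by rewrite def_iu mem_cycle.
  have [l [l_odd def_iu2 xl]] := cycle_sqrt m_gt0 ox oi iu_x.
  have inv_iu : i v * i u * (i v)^-1 = (i u)^-1.
    by rewrite -!morphV ?inE // -!morphM ?inE // vuv.
  have [k' [def_iv|def_iv]] := fdic_nf e_bij (i v).
    move: inv_iu; rewrite def_iu def_iv -expgnDr addnC expgnDr mulgK.
    rewrite -def_iu => iu2.
    have : (i u) ^+ 2 == 1 by rewrite expg2 {1}iu2 mulVg.
    rewrite -order_dvdn oi => /dvdn_leq => /(_ isT).
    rewrite leqNgt => /negP[]; apply: (@leq_trans (2 * 3)) => //.
    by rewrite leq_pmul2l.
  have [|p [px py]] := @dic_lift G q (x ^+ l) (i v).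
    split; rewrite def_iv.
      rewrite (dic_sqr xy) -xqy expgnAC (@expg_odd _ (x ^+ q) l) //.
      rewrite -expgnA mulnC; exact: (dic_X2m xy).
    exact: dic_conj_nf xy _ _.
  exists p; rewrite homX px -def_iu2; split=> //.
  apply: (dic_surj e_bij); first by
    have /cycleP[j def_x] := xl; exists (gx ^+ j); rewrite homX px -def_x.
  have /cycleP[j def_x] := xl; exists (gx ^- (j * k') * gy).
  by rewrite gmulfM homV homX px py expgnA -def_x def_iv mulKg.
have [p1 [surj1 p1u p1v]] := cover _ inj1.
have [p2 [surj2 p2u p2v]] := cover _ inj2.
apply: (amalgam_of_covers index1 index2 isoG surj1 surj2) => //.
by apply: (covered_gens e'_bij) => -[]; [exists (gx ^+ 2) | exists gy].
Qed.
End Cases.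

(** * The group K_1 *)

Lemma dicyclic2_exp4 (H : finGroupType) (h : H) :
  isomorphic H (dicyclic 2) -> h ^+ 4 = 1.
Proof.
move=> /isomorphic_sym[d d_bij]; have uv := fdic_gens d.
have [k [] ->] := fdic_nf d_bij h; last exact: (dic_exp4 uv).
by rewrite expgnAC (dic_X2m uv) expg1n.
Qed.

Lemma sign_semidirect_iso (P P' : groupType) (G : finGroupType) (N : {set G}) :
  isomorphic P P' -> sign_semidirect P' N -> sign_semidirect P N.
Proof.
move=> PP' [th [thE iso]]; exists th; split=> //.
exact: isomorphic_trans iso.
Qed.

(** As x has order 8 and N has exponent 4, x is outside N; so N contains x^2 and
    one of y, x y, which is called z. Then x and z are dicyclic generators, and K_1 is the double
    of G along <x^2, z> = N, with copies generated by x, y and by a, b. *)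
Lemma K1_sign_semidirect (G : finGroupType) (N : {group G}) :
  #|[set: G] : N| = 2 -> isomorphic G (dicyclic 4) ->
  {in N, forall n, n ^+ 4 = 1} -> sign_semidirect K1 N.
Proof.
move=> index isoG N4; have cM := notin_index2M index.
have [e e_bij] := isomorphic_sym isoG.
set gx := pgen (dic_rel 4) Dic_x; set gy := pgen (dic_rel 4) Dic_y.
have xy := fdic_gens e; set x := e gx in xy *; set y := e gy in xy *.
have ox : #[x] = 8 := fdic_order (isT : 0 < 4)%N e_bij.
have xN : x \notin N.
  by apply/negP => /N4/eqP; rewrite -order_dvdn ox.
(* Replacing y by x y is the automorphism of Q_16 that exchanges its two
   quaternion subgroups of index 2. *)
pose z := if y \in N then y else x * y.
have xz : dic_gens 4 x z.
  rewrite /z; case: ifP => // _; split.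
    by have := dic_sqr xy 1; rewrite -xy.1.
  exact: (dic_conj_nf xy 1 1).
have zN : z \in N.
  rewrite /z; case: ifPn => // yN.
  by apply/negPn; rewrite cM xN yN.
have [p [px pz]] := dic_lift xz.
have p_surj : forall g, exists w, p w = g.
  apply: (dic_surj e_bij); first by exists gx.
  have [yN|yN] := boolP (y \in N); first by exists gy; rewrite pz /z yN.
  by exists (gx^-1 * gy); rewrite gmulfM homV px pz /z (negPf yN) mulKg.
have p_bij := hom_surj_bij isoG p_surj.
have [p' pK p'K] := inverse_hom p_bij.
have kx4 := presented_rel K1_powx; have ka4 := presented_rel K1_powa.
have kx2 := presented_rel K1_conjx; have ka2 := presented_rel K1_conja.
have kxa := presented_rel K1_glue2; have kyb := presented_rel K1_glue1.
rewrite !gterm_evalX /= in kx4 ka4 kx2 ka2 kxa kyb.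
have [A0 [A0x A0y]] := dic_lift (conj kx4 kx2 : dic_gens 4 _ _).
have [B0 [B0x B0y]] := dic_lift (conj ka4 ka2 : dic_gens 4 _ _).
pose A : {multiplicative G -> K1} := A0 \o p'.
pose B : {multiplicative G -> K1} := B0 \o p'.
pose ZG := semidirect (sign_action cM).
pose v (k : K1_gen) : ZG :=
  match k with
  | K1_x => (0%R, x) | K1_y => (0%R, z) | K1_a => (1%R, x) | K1_b => (0%R, z)
  end.
have [phi phiE] : exists phi : {multiplicative presented K1_rel -> ZG},
    forall k, phi (pgen K1_rel k) = v k.
  have z0 g n : ((0%R, g) : ZG) ^+ n = (0%R, g ^+ n).
    by elim: n => [|n IHn] //; rewrite !expgS IHn sdM sign_act0.
  have ax2 : ((1%R, x) : ZG) ^+ 2 = (0%R, x ^+ 2).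
    by rewrite !expg2 sdM /sign_act xN.
  apply: presented_lift => u w []; rewrite ?gterm_evalX /=.
  - by rewrite !z0 xz.1.
  - by rewrite (expgnA _ 2 2) ax2 !z0 -expgnA xz.1.
  - by rewrite sd_conj sign_act0 xz.2 sdV sign_act0.
  - by rewrite sd_conj xz.2 sdV /sign_act groupV xN zN.
  - by rewrite z0 ax2.
  - by [].
have phiA0 w : phi (A0 w) = (0%R, p w).
  elim/presented_ind: w => [|u w IHu IHw|u IHu|[]].
  - by rewrite !hom1.
  - by rewrite !gmulfM IHu IHw sdM sign_act0.
  - by rewrite !homV IHu sdV sign_act0.
  - by rewrite A0x phiE px.
  - by rewrite A0y phiE pz.
have phiB0 w : phi (B0 w) = (((p w \notin N) : nat) : int, p w).
  elim/presented_ind: w => [|u w IHu IHw|u IHu|[]].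
  - by rewrite !hom1 group1.
  - rewrite !gmulfM IHu IHw sdM /sign_act (cM (p u)).
    by case: (p u \notin _) (p w \notin _) => [] [].
  - rewrite !homV IHu sdV /sign_act !groupV.
    by case: (_ \notin _); rewrite ?GRing.oppr0 ?GRing.opprK.
  - by rewrite B0x phiE px xN.
  - by rewrite B0y phiE pz zN.
apply: (sign_semidirect_char (cM := cM)).
apply: (double_semidirect (A := A) (B := B) (phi := phi) xN).
- move=> g; rewrite negbK /A /B /=.
  have even_agree k : A0 (gx ^+ (2 * k)) = B0 (gx ^+ (2 * k)).
    by rewrite !expgnA !homX A0x B0x kxa.
  have parity k : (x ^+ k \notin N) = odd k.
    elim: k => [|k IHk]; first by rewrite group1.
    by rewrite expgS cM xN IHk.
  have evenN k : x ^+ k \in N -> exists k', k = (2 * k')%N.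
    move/negPn; rewrite parity => k_even; exists k./2.
    by rewrite -[LHS]odd_double_half (negPf k_even) mul2n.
  have [k [] ->] := fdic_nf p_bij g; rewrite px ?pz.
    by move/evenN => [k' ->]; rewrite -px -homX pK even_agree.
  rewrite groupMr // => /evenN[k' ->]; rewrite -px -pz -homX -gmulfM pK.
  by rewrite !gmulfM even_agree A0y B0y kyb.
- move=> Q Q1 QA QB q.
  have QA0 w u : Q u -> Q (A0 w * u) by move=> Qu; rewrite -[w]pK; apply: QA.
  have QB0 w u : Q u -> Q (B0 w * u) by move=> Qu; rewrite -[w]pK; apply: QB.
  elim/presented_left_ind: q => [//|[] u Qu|[] u Qu].
  + by rewrite -A0x; apply: QA0.
  + by rewrite -A0y; apply: QA0.
  + by rewrite -B0x; apply: QB0.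
  + by rewrite -B0y; apply: QB0.
  + by rewrite -A0x -homV; apply: QA0.
  + by rewrite -A0y -homV; apply: QA0.
  + by rewrite -B0x -homV; apply: QB0.
  + by rewrite -B0y -homV; apply: QB0.
- by move=> g; rewrite /A /= phiA0 p'K.
- by move=> g; rewrite /B /= phiB0 p'K.
Qed.

(** * Binary tetrahedral and octahedral groups *)

(** The relations of the binary polyhedral group <2,m,n> in terms of s and t,
    after r = s t has been eliminated. *)
Definition bp_pair (Q : groupType) (m n : nat) (s t : Q) :=
  s ^+ m = (s * t) ^+ 2 /\ t ^+ n = (s * t) ^+ 2.

Section BinaryPolyhedral.
Variables (m n : nat).
Let r := pgen (bp_rel 2 m n) Bp_r.
Let s := pgen (bp_rel 2 m n) Bp_s.
Let t := pgen (bp_rel 2 m n) Bp_t.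

Lemma bp_r : r = s * t.
Proof.
have := presented_rel (Bp_rpow 2 m n); rewrite gterm_evalX /= expg2 -mulgA.
exact: mulgI.
Qed.

Lemma bp_pgen : bp_pair m n s t.
Proof.
have rt := presented_rel (Bp_rpow 2 m n); rewrite gterm_evalX /= -/r in rt.
split; rewrite -bp_r rt.
  by have := presented_rel (Bp_spow 2 m n); rewrite gterm_evalX.
by have := presented_rel (Bp_tpow 2 m n); rewrite gterm_evalX.
Qed.

Lemma bp_lift (Q : groupType) (x y : Q) : bp_pair m n x y ->
  exists f : {multiplicative binary_polyhedral 2 m n -> Q}, f s = x /\ f t = y.
Proof.
case=> xm yn.
have [|f fE] := @presented_lift _ (bp_rel 2 m n) Q
    (fun g => match g with Bp_r => x * y | Bp_s => x | Bp_t => y end).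
  by move=> u w []; rewrite gterm_evalX /= ?xm ?yn expg2 !mulgA.
by exists f; rewrite !fE.
Qed.
End BinaryPolyhedral.

Lemma expg3 (Q : groupType) (x : Q) : x ^+ 3 = x * x * x.
Proof. exact: mulgA. Qed.

(** Normal forms in the binary tetrahedral group. Here z is the central element
    -1, and a, b generate the quaternion subgroup, which s normalizes:
    s^-1 a s = b and s^-1 b s = z a b. Every element is s^k z^e a^f b^g. *)
Section BinaryTetrahedralRelations.
Variables (Q : groupType) (s u : Q).
Hypothesis su : bp_pair 3 3 s u.
Let z := s ^+ 3.
Let a := s * u.
Let b := u * s.

Fact tet_u3 : u ^+ 3 = z. Proof. by rewrite /z su.1 su.2. Qed.
Fact tet_a2 : a * a = z. Proof. by rewrite /z su.1 expg2. Qed.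
Fact tet_zs : commute z s. Proof. exact/commute_sym/commuteX. Qed.
Fact tet_zu : commute z u.
Proof. by rewrite -tet_u3; exact/commute_sym/commuteX. Qed.
Fact tet_za : commute z a. Proof. exact: (commuteM tet_zs tet_zu). Qed.
Fact tet_zb : commute z b. Proof. exact: (commuteM tet_zu tet_zs). Qed.

Fact tet_uu : s * u * s = u * u.
Proof.
by apply: (@mulIg _ u); have := tet_a2; rewrite /a mulgA -tet_u3 expg3.
Qed.

Fact tet_ss : u * s * u = s * s.
Proof.
apply: (@mulgI _ s); have := tet_a2; rewrite /a !mulgA => ->.
by rewrite /z expg3 ?mulgA.
Qed.

(** With w = s u^2 s, expanding u^2 as s u s and s^2 as u s u and extracting
    cubes returns w = z^2 w. *)
Lemma tet_z2 : z * z = 1.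
Proof.
have E1 : s * (u * u) * s = u * s * u * u * (u * s * u).
  by rewrite -tet_uu tet_ss !mulgA.
have uuu w : w * u * u * u = w * z by rewrite -tet_u3 expg3 ?mulgA.
have sss w : w * s * s * s = w * z by rewrite /z expg3 ?mulgA.
have E2 : u * s * u * u * (u * s * u) = z * (u * (s * s) * u).
  rewrite !mulgA uuu.
  by rewrite -[_ * z](commuteM tet_zu tet_zs) !mulgA.
have E3 : u * (s * s) * u = z * (s * (u * u) * s).
  rewrite -tet_ss !mulgA -[u * u * s * u * u]mulgA -tet_uu !mulgA sss.
  by rewrite -[_ * z](commuteM tet_zs tet_zu) !mulgA.
apply: (@mulIg _ (s * (u * u) * s)).
by rewrite mul1g -(mulgA z) -E3 -E2 -E1.
Qed.

Fact tet_as : a * s = s * b. Proof. by rewrite /a /b mulgA. Qed.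

Fact tet_b2 : b * b = z.
Proof.
apply: (@mulgI _ s); rewrite mulgA -tet_as -mulgA -tet_as mulgA tet_a2.
exact: tet_zs.
Qed.

Fact tet_suus : s * u * u * s = s * s * u * s * s.
Proof. by rewrite -(mulgA s u u) -tet_uu !mulgA. Qed.

Fact tet_bs : b * s = s * z * a * b.
Proof.
have -> : s * z * a * b = z * s * (s * u * u * s).
  by rewrite -tet_zs /a /b !mulgA.
rewrite tet_suus /b !mulgA -(mulgA z s s) -(mulgA z) -expg3 -/z.
by rewrite tet_z2 mul1g.
Qed.

Fact tet_bab : b * a * b = a.
Proof.
have -> : b * a * b = u * s * (s * u * u * s) by rewrite /a /b !mulgA.
have -> : u * s * (s * u * u * s) = u * (s * s * s) * (u * s * s).
  by rewrite tet_suus !mulgA.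
rewrite -expg3 -/z -tet_zu -mulgA.
have -> : u * (u * s * s) = s * u * (s * s * s) by rewrite !mulgA -tet_uu.
by rewrite -expg3 -/z -tet_za mulgA tet_z2 mul1g.
Qed.

Fact tet_ba : b * a = z * a * b.
Proof.
apply: (@mulIg _ b).
by rewrite tet_bab -mulgA tet_b2 -mulgA -tet_za mulgA tet_z2 mul1g.
Qed.
End BinaryTetrahedralRelations.

(** In the octahedral group, t normalizes the tetrahedral subgroup and t^2 = a,
    so the 48 elements are s^k z^e a^f b^g t^d. They are encoded by their
    exponents, with None, Some false, Some true for k = 0, 1, 2: this type
    reduces by computation, and destructs into closed cases. *)
Definition tet_code : Type := (option bool * bool * bool * bool)%type.
Definition oct_code : Type := (tet_code * bool)%type.

(** Right multiplication by s: a s = s b, b s = s z a b and a b s = s z a, with a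
    further z = s^3 when k passes from 2 to 0. *)
Definition tet_mulr_s (x : tet_code) :=
  let: (k, e, f, g) := x in
  match k with
  | None => (Some false, e (+) g, g, f (+) g)
  | Some false => (Some true, e (+) g, g, f (+) g)
  | Some true => (None, ~~ (e (+) g), g, f (+) g)
  end.

(** Right multiplication by a: a^2 = z and b a = z a b. *)
Definition tet_mulr_a (x : tet_code) :=
  let: (k, e, f, g) := x in (k, e (+) (f (+) g), ~~ f, g).

(** t s = u t, where u = s^-1 a = s^5 a. *)
Definition oct_mulr_s (x : oct_code) : oct_code :=
  if x.2 then (tet_mulr_a (iter 5 tet_mulr_s x.1), true)
  else (tet_mulr_s x.1, false).

Definition oct_mulr_t (x : oct_code) : oct_code :=
  if x.2 then (tet_mulr_a x.1, false) else (x.1, true).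

Definition oct1 : oct_code := (None, false, false, false, false).

Definition oct_step (x : oct_code) (l : bool) :=
  if l then oct_mulr_s x else oct_mulr_t x.

(** A positive word for each normal form, true being s and false being t; in it
    a is t t, and b = s^-1 a s is s^5 t t s. *)
Definition oct_word (x : oct_code) : seq bool :=
  let: (k, e, f, g, d) := x in
  match k with
  | None => [::] | Some false => [:: true] | Some true => [:: true; true]
  end
  ++ (if e then [:: true; true; true] else [::])
  ++ (if f then [:: false; false] else [::])
  ++ (if g then nseq 5 true ++ [:: false; false; true] else [::])
  ++ (if d then [:: false] else [::]).

Definition oct_mul (x y : oct_code) : oct_code := foldl oct_step x (oct_word y).

Definition oct_all : seq oct_code :=
  let extend (A : Type) (l : seq A) :=
    [seq (x, y) | x <- l, y <- [:: false; true]] in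
  extend _ (extend _ (extend _ (extend _ [:: None; Some false; Some true]))).

Lemma mem_oct_all x : x \in oct_all.
Proof. by case: x => [[[[[[]|] []] []] []] []]. Qed.

Lemma oct_word1 x : foldl oct_step oct1 (oct_word x) = x.
Proof. by case: x => [[[[[[]|] []] []] []] []]. Qed.

(** The pair of codes satisfies the tetrahedral relations and its cube, the
    candidate for -1, is not trivial; this excludes pairs that only generate a
    cyclic group. *)
Definition oct_tet_pair (x y : oct_code) : bool :=
  let x3 := oct_mul (oct_mul x x) x in
  let xy := oct_mul x y in
  [&& x3 != oct1, oct_mul (oct_mul y y) y == x3 & oct_mul xy xy == x3].

(** Conjugation by w sends x to y, and w^2 = x y: these are the relations that
    tie t to s and u = t s t^-1. *)
Definition oct_root (x y w : oct_code) : bool :=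
  (oct_mul w w == oct_mul x y) && (oct_mul w x == oct_mul y w).

Fact oct_root_all :
  all (fun x => all (fun y => oct_tet_pair x y ==> has (oct_root x y) oct_all)
    oct_all) oct_all.
Proof. by vm_compute. Qed.

(** Any two embeddings of the binary tetrahedral group are conjugate, and the
    defining one has such a w, namely t. The search over all pairs of codes
    replaces the classification of the embeddings. *)
Lemma oct_pair_root (x y : oct_code) : oct_tet_pair x y ->
  exists w, oct_mul w w = oct_mul x y /\ oct_mul w x = oct_mul y w.
Proof.
have := oct_root_all; move: mem_oct_all; move: oct_all => l mem_l.
move=> /allP/(_ x (mem_l x))/allP/(_ y (mem_l y))/implyP root xy.
by have /hasP[w _ /andP[/eqP w2 /eqP wx]] := root xy; exists w.
Qed.

(** The rules of right multiplication are bijective as s^6 = t^8 = 1. *)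
Fact oct_mulr_sK : cancel oct_mulr_s (iter 5 oct_mulr_s).
Proof. by case=> [[[[[[]|] []] []] []] []]. Qed.

Fact oct_mulr_tK : cancel oct_mulr_t (iter 7 oct_mulr_t).
Proof. by case=> [[[[[[]|] []] []] []] []]. Qed.

Definition oct_perm_s : {perm oct_code} := perm (can_inj oct_mulr_sK).
Definition oct_perm_t : {perm oct_code} := perm (can_inj oct_mulr_tK).

(** The right regular representation of the octahedral group on the codes; it
    shows that the 48 normal forms are distinct. *)
Lemma oct_perm_pair : bp_pair 3 4 oct_perm_s oct_perm_t.
Proof.
by split; apply/permP => x; rewrite !expgS !expg0 !permM !perm1 !permE;
   case: x => [[[[[[]|] []] []] []] []].
Qed.

(** The consequences of the relations of the previous section on normal forms,
    with an arbitrary prefix c in place of the power of s. *)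
Section TetNormalForm.
Variables (Q : groupType) (s z a b : Q).
Hypotheses (z2 : z * z = 1) (aa : a * a = z).
Hypotheses (zs : commute z s) (za : commute z a) (zb : commute z b).
Hypotheses (as_sb : a * s = s * b) (bs : b * s = s * z * a * b).
Hypotheses (bab : b * a * b = a) (ba : b * a = z * a * b).

Fact expg_addb (e h : bool) : z ^+ (e (+) h) = z ^+ e * z ^+ h.
Proof. by case: e h => [] []; rewrite ?mulg1 ?mul1g // expg1 z2. Qed.

Lemma tet_nf_s c (e f g : bool) : c * z ^+ e * a ^+ f * b ^+ g * s
    = c * s * z ^+ (e (+) g) * a ^+ g * b ^+ (f (+) g).
Proof.
have core : a ^+ f * b ^+ g * s = s * z ^+ g * a ^+ g * b ^+ (f (+) g).
  case: f g => [] []; rewrite ?expg0 ?expg1 ?mul1g ?mulg1 //.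
  rewrite -mulgA bs !mulgA as_sb -(mulgA s b) -zb !mulgA.
  by rewrite -!(mulgA (s * z)) bab.
have zes : commute (z ^+ e) s by apply/commute_sym/commuteX/commute_sym.
rewrite -!mulgA (mulgA (a ^+ f)) core expg_addb !mulgA -(mulgA c _ s) zes.
by rewrite !mulgA.
Qed.

Lemma tet_nf_a c (e f g : bool) : c * z ^+ e * a ^+ f * b ^+ g * a
    = c * z ^+ (e (+) (f (+) g)) * a ^+ (~~ f) * b ^+ g.
Proof.
rewrite expg_addb -!mulgA; do 2!congr (_ * _).
case: f g => [] []; rewrite ?expg0 ?expg1 ?mul1g ?mulg1 ?ba ?mulgA //.
by rewrite -za -(mulgA z) aa z2 mul1g.
Qed.
End TetNormalForm.

Section OctEval.
Variables (Q : groupType) (s t : Q).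
Hypothesis st : bp_pair 3 4 s t.

Fixpoint oct_evl (l : seq bool) : Q :=
  if l is b :: l then (if b then s else t) * oct_evl l else 1.
Definition oct_ev x := oct_evl (oct_word x).

Lemma oct_evl_cat l1 l2 : oct_evl (l1 ++ l2) = oct_evl l1 * oct_evl l2.
Proof. by elim: l1 => [|b l1 IHl] /=; rewrite ?mul1g // IHl mulgA. Qed.

Let u := t * s * t^-1.
Let z := s ^+ 3.
Let a := s * u.
Let b := u * s.

Lemma oct_tt : t * t = a.
Proof.
apply: (@mulIg _ (t * t)); rewrite /a /u !mulgA mulgVK.
by have := st.2; rewrite !expgS !expg0 !mulg1 !mulgA.
Qed.

(** The tetrahedral subgroup: s and its conjugate u satisfy its relations,
    because s u = t^2. *)
Lemma oct_su : bp_pair 3 3 s u.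
Proof.
have u3 : u ^+ 3 = s ^+ 3.
  have -> : u = s ^ t^-1 by rewrite conjgE invgK mulgA.
  rewrite -conjXg; apply/conjg_fixP/commgP.
  by apply: commuteV; rewrite st.1 -st.2; apply/commute_sym/commuteX.
by split; rewrite ?u3 st.1 -st.2 -/a -oct_tt -expg2 -expgnA.
Qed.


Lemma oct_evE k e f g d : oct_ev (k, e, f, g, d) =
  (match k with None => 1 | Some false => s | Some true => s * s end)
  * z ^+ e * a ^+ f * b ^+ g * t ^+ d.
Proof.
have z2 : z * z = 1 := tet_z2 oct_su.
have s6 : s ^+ 6 = 1 by rewrite (expgnA _ 3 2).
have bE : b = oct_evl [:: true; true; true; true; true; false; false; true].
  have := tet_as s u; rewrite -/a -/b => as_sb; apply: (@mulgI _ s).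
  rewrite -as_sb -oct_tt /= !mulgA mulg1 -[LHS]mul1g -[in LHS]s6.
  by rewrite !expgS expg0 !mulg1 !mulgA.
rewrite /oct_ev /oct_word !oct_evl_cat !mulgA; congr (_ * _ * _ * _ * _).
- by case: k => [[]|]; rewrite /= ?mulg1.
- by case: e; rewrite /= ?mulg1 /z ?expg3 ?mulgA.
- by case: f; rewrite /= ?mulg1 ?oct_tt.
- by case: g => //; rewrite expg1 bE.
- by case: d; rewrite /= ?mulg1.
Qed.

Lemma oct_ev_t (x : tet_code) :
  oct_ev (x, true) = oct_ev (x, false) * t.
Proof. by case: x => [[[k e] f] g]; rewrite !oct_evE mulg1. Qed.

Lemma tet_mulr_sE x : oct_ev (x, false) * s = oct_ev (tet_mulr_s x, false).
Proof.
have step := tet_nf_s (tet_z2 oct_su) (tet_zs s) (tet_zb oct_su) (tet_as s u)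
  (tet_bs oct_su) (tet_bab oct_su).
case: x => [[[k e] f] g]; rewrite oct_evE expg0 mulg1 step.
case: k => [[]|]; rewrite /= oct_evE expg0 mulg1 ?mul1g //.
by rewrite -expg3 -addTb (expg_addb (tet_z2 oct_su) true).
Qed.

Lemma tet_mulr_aE x : oct_ev (x, false) * a = oct_ev (tet_mulr_a x, false).
Proof.
case: x => [[[k e] f] g]; rewrite /= !oct_evE !expg0 !mulg1.
exact: (tet_nf_a (tet_z2 oct_su) (tet_a2 oct_su) (tet_za oct_su)
                 (tet_ba oct_su)).
Qed.

Lemma oct_stepE x l : oct_ev x * (if l then s else t) = oct_ev (oct_step x l).
Proof.
case: x l => x [] []; rewrite /oct_step /oct_mulr_s /oct_mulr_t /=.
- rewrite !oct_ev_t; have -> : oct_ev (x, false) * t * s =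
       oct_ev (x, false) * s * s * s * s * s * a * t.
    have ss : s * s * s * s * s * a = u.
      have s6 := tet_z2 oct_su; rewrite expg3 !mulgA in s6.
      by rewrite /a (mulgA _ s u) s6 mul1g.
    have -> : oct_ev (x, false) * t * s = oct_ev (x, false) * u * t.
      by rewrite /u !mulgA mulgVK.
    by rewrite -ss !mulgA.
  by rewrite !tet_mulr_sE tet_mulr_aE.
- by rewrite oct_ev_t -mulgA oct_tt tet_mulr_aE.
- exact: tet_mulr_sE.
- by rewrite oct_ev_t.
Qed.

Lemma oct_mulE x y : oct_ev x * oct_ev y = oct_ev (oct_mul x y).
Proof.
rewrite /oct_mul {2}/oct_ev; elim: (oct_word y) x => [|l w IHw] x /=.
  by rewrite mulg1.
by rewrite mulgA oct_stepE IHw.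
Qed.

End OctEval.

Section BinaryOctahedral.
Let s := pgen (bp_rel 2 3 4) Bp_s.
Let t := pgen (bp_rel 2 3 4) Bp_t.
Let st : bp_pair 3 4 s t := bp_pgen 3 4.
Local Notation ev := (oct_ev s t).

Lemma oct_ev_surj (g : binary_octahedral) : exists x, ev x = g.
Proof.
pose Q g := forall x, exists y, ev y = ev x * g.
have Qs w : Q w -> Q (s * w).
  by move=> Qw x; rewrite mulgA (oct_stepE st x true); apply: Qw.
have Qt w : Q w -> Q (t * w).
  by move=> Qw x; rewrite mulgA (oct_stepE st x false); apply: Qw.
have Qsn n w : Q w -> Q (s ^+ n * w).
  by move=> Qw; elim: n => [|n IHn]; rewrite ?mul1g // expgS -mulgA; apply: Qs.
have Qtn n w : Q w -> Q (t ^+ n * w).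
  by move=> Qw; elim: n => [|n IHn]; rewrite ?mul1g // expgS -mulgA; apply: Qt.
have z2 := tet_z2 (oct_su st).
have sV : s^-1 = s ^+ 5.
  by apply: mulg1_eq; rewrite -expgS (expgnA _ 3 2) expg2.
have tV : t^-1 = t ^+ 7.
  by apply: mulg1_eq; rewrite -expgS (expgnA _ 4 2) st.2 -st.1 expg2.
suff Qg : Q g by have [y ey] := Qg oct1; exists y; rewrite ey mul1g.
have Qr : pgen (bp_rel 2 3 4) Bp_r = s * t := bp_r 3 4.
elim/presented_left_ind: g => [|[] w Qw|[] w Qw].
- by move=> x; exists x; rewrite mulg1.
- by rewrite Qr -mulgA; apply/Qs/Qt.
- exact: Qs.
- exact: Qt.
- by rewrite Qr invgM -mulgA sV tV; apply/Qtn/Qsn.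
- by rewrite -/s sV; apply: Qsn.
- by rewrite -/t tV; apply: Qtn.
Qed.

(** The representation by permutations sends the first code to x under the
    normal form with code x. *)
Lemma oct_ev_inj : injective ev.
Proof.
have [f [fs ft]] := bp_lift oct_perm_pair.
have fE l (x : oct_code) :
    (f (oct_evl s t l) : {perm _}) x = foldl oct_step x l.
  elim: l x => [|l w IHw] x /=; first by rewrite hom1 perm1.
  by rewrite gmulfM permM IHw; case: l; rewrite ?fs ?ft permE.
move=> x y xy; rewrite -(oct_word1 x) -(oct_word1 y) -!fE.
by move: xy; rewrite /ev => ->.
Qed.

Lemma oct_ev1 : ev oct1 = 1. Proof. by []. Qed.

(** Any tetrahedral pair in the octahedral group extends to octahedral
    generators s1, t1 with u1 = t1 s1 t1^-1. *)
Lemma tet_pair_extends (s1 u1 : binary_octahedral) :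
  bp_pair 3 3 s1 u1 -> s1 ^+ 3 <> 1 ->
  exists t1, t1 * t1 = s1 * u1 /\ t1 * s1 = u1 * t1.
Proof.
have [x <-] := oct_ev_surj s1; have [y <-] := oct_ev_surj u1.
rewrite /bp_pair !expg3 expg2 !oct_mulE // -oct_ev1.
move=> [/oct_ev_inj x3 /oct_ev_inj y3] x3_neq1.
have [|w [w2 wx]] := @oct_pair_root x y.
  rewrite /oct_tet_pair y3 x3 !eqxx !andbT -x3; apply/eqP => e.
  by apply: x3_neq1; rewrite e.
by exists (ev w); rewrite !oct_mulE // w2 wx.
Qed.

Lemma oct_s3 : s ^+ 3 <> 1.
Proof. 
rewrite expg3; have -> : s = ev (Some false, false, false, false, false).
  by rewrite /ev /= mulg1.
by rewrite !oct_mulE // -oct_ev1 => /oct_ev_inj.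
Qed.
End BinaryOctahedral.

Lemma bp_pair_hom (A B : groupType) (f : {multiplicative A -> B}) m n
    (s t : A) :
  bp_pair m n s t -> bp_pair m n (f s) (f t).
Proof. by case=> sm tn; split; rewrite -gmulfM -!homX ?sm ?tn. Qed.

(** The abelianization Z_3 sends s to 1 and t to 2. *)
Lemma tet_gens_not_conj (h : binary_tetrahedral) :
  h * pgen (bp_rel 2 3 3) Bp_s <> pgen (bp_rel 2 3 3) Bp_t * h.
Proof.
have [|f [fs ft]] := @bp_lift 3 3 'Z_3 (inZp 1) (inZp 2).
  by split; apply: val_inj.
move/(congr1 f); rewrite !gmulfM fs ft [f h * _]Zp_mulgC.
by move=> /mulIg/(congr1 val).
Qed.

(** The order of s can be computed in the octahedral group, where s and its
    conjugate by t are tetrahedral generators. *)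
Lemma tet_s3 : pgen (bp_rel 2 3 3) Bp_s ^+ 3 <> 1.
Proof.
have [f [fs _]] := bp_lift (oct_su (bp_pgen 3 4)).
by move/(congr1 f); rewrite homX fs hom1; apply: oct_s3.
Qed.

Section OctahedralCase.
Variables (G H : finGroupType) (i1 i2 : {morphism [set: H] >-> G}).
Hypotheses (inj1 : 'injm i1) (inj2 : 'injm i2).
Hypothesis index1 : #|[set: G] : i1 @* [set: H]| = 2.
Hypothesis index2 : #|[set: G] : i2 @* [set: H]| = 2.
Variable N : {set G}.
Hypothesis hN : N = i1 @* [set: H] \/ N = i2 @* [set: H].

(** For each embedding i, s and t of H are covered by S and T S T^-1, where S
    goes to i(s) and T to the element y found in [tet_pair_extends]. The image
    contains i(H) and y, which is not in i(H) since s and t are not conjugate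
    in H; as i(H) has index 2, the image is G. *)
Lemma case_octahedral : isomorphic G binary_octahedral ->
  isomorphic H binary_tetrahedral -> sign_semidirect (amalgam i1 i2) N.
Proof.
move=> isoG isoH.
have [e e_bij] := isomorphic_sym isoG; have [e' eK e'K] := inverse_hom e_bij.
have [d d_bij] := isomorphic_sym isoH; have d_inj := bij_inj d_bij.
set S := pgen (bp_rel 2 3 4) Bp_s; set T := pgen (bp_rel 2 3 4) Bp_t.
set s := d (pgen (bp_rel 2 3 3) Bp_s); set t := d (pgen (bp_rel 2 3 3) Bp_t).
have dr : d (pgen (bp_rel 2 3 3) Bp_r) = s * t by rewrite bp_r gmulfM.
have st : bp_pair 3 3 s t := bp_pair_hom d (bp_pgen 3 3).
have cover (i : {morphism [set: H] >-> G}) : 'injm i ->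
  #|[set: G] : i @* [set: H]| = 2 ->
  exists p : {multiplicative binary_octahedral -> G},
    [/\ (forall y, exists w, p w = y), p S = i s & p (T * S * T^-1) = i t].
  move=> inj index.
  have iM : {morph i : x y / x * y} by move=> x y; rewrite morphM ?inE.
  have [j jE] := homM_exists iM.
  have j_inj : injective j.
    by move=> x y; rewrite !jE => /(injmP inj); apply; rewrite inE.
  have jst := bp_pair_hom j st.
  have [||t1 []] := @tet_pair_extends (e' (j s)) (e' (j t)).
  - exact: bp_pair_hom.
  - rewrite -!homX -(hom1 e') => /(can_inj e'K); rewrite -(hom1 j) => /j_inj.
    by rewrite -(hom1 d) => /d_inj; apply: tet_s3.
  move=> /(congr1 e); rewrite !gmulfM !e'K => t1t1.
  move=> /(congr1 e); rewrite !gmulfM !e'K => t1s.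
  set y := e t1 in t1t1 t1s.
  have jsy : j s * y * (j s * y) = j s * j t * (j s * j t).
    by rewrite -mulgA (mulgA y) t1s -mulgA t1t1 !mulgA.
  have [|p [pS pT]] := @bp_lift 3 4 G (j s) y.
    split; rewrite expg2 jsy -expg2; first exact: jst.1.
    by rewrite (expgnA _ 2 2) (expg2 y) t1t1.
  have pU : p (T * S * T^-1) = j t by rewrite !gmulfM homV pS pT t1s mulgK.
  exists p; rewrite -!jE; split=> // g.
  have im h : exists w, p w = j h.
    case: d_bij => d' _ d'K; rewrite -(d'K h).
    elim/presented_ind: (d' h) => [|x z [w1 e1] [w2 e2]|x [w1 e1]|[]].
    - by exists 1; rewrite !hom1.
    - by exists (w1 * w2); rewrite !gmulfM e1 e2.
    - by exists w1^-1; rewrite !homV e1.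
    - by exists (S * (T * S * T^-1)); rewrite dr [LHS]gmulfM [RHS]gmulfM pS pU.
    - by exists S; rewrite pS.
    - by exists (T * S * T^-1); rewrite pU.
  have imK g' : g' \in i @* [set: H] -> exists w, p w = g'.
    by case/morphimP => h _ _ ->; rewrite -jE.
  have yK : y \notin i @* [set: H].
    apply/negP => /morphimP[h _ _]; rewrite -jE => yh.
    move: t1s; rewrite yh -!gmulfM => /j_inj.
    case: d_bij => d' _ d'K; rewrite -(d'K h) -!gmulfM => /d_inj.
    exact: tet_gens_not_conj.
  have [gK|gK] := boolP (g \in i @* [set: H]); first exact: imK.
  have [|w pw] := imK (g * y^-1).
    by apply/negPn; rewrite (notin_index2M index) groupV yK gK.
  by exists (w * T); rewrite gmulfM pw pT mulgVK.
have [p1 [surj1 p1s p1t]] := cover _ inj1 index1.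
have [p2 [surj2 p2s p2t]] := cover _ inj2 index2.
apply: (amalgam_of_covers index1 index2 isoG surj1 surj2) => //.
have cs : covered i1 i2 p1 p2 s by exists S.
have ct : covered i1 i2 p1 p2 t by exists (T * S * T^-1).
by apply: (covered_gens d_bij) => -[] //; rewrite dr; apply: coveredM.
Qed.
End OctahedralCase.

Theorem corollary76 (q : nat) (G H : finGroupType)
    (i1 i2 : {morphism [set: H] >-> G})
    (inj1 : 'injm i1) (inj2 : 'injm i2)
    (index1 : #|[set: G] : i1 @* [set: H]| = 2)
    (index2 : #|[set: G] : i2 @* [set: H]| = 2)
    (cases :
      [\/ (* (a) *)
          ((1 <= q)%N /\ isomorphic G 'Z_(4 * q)
             \/ (2 <= q)%N /\ isomorphic G (dicyclic q))
            /\ isomorphic H 'Z_(2 * q),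
          (* (b) *)
          [/\ (6 <= q)%N, ~~ odd q, isomorphic G (dicyclic q)
            & isomorphic H (dicyclic q./2)],
          (* (c) *)
          [/\ q = 4, isomorphic G (dicyclic 4), isomorphic H (dicyclic 2)
            & isomorphic (amalgam i1 i2) K1]
        | (* (d) *)
          isomorphic G binary_octahedral
            /\ isomorphic H binary_tetrahedral])
    (N : {set G}) (hN : N = i1 @* [set: H] \/ N = i2 @* [set: H]) :
  exists th : add_action G int,
    (forall g : G,
       let t := sd_inl th 1%R in
       sd_inr th g * t * (sd_inr th g)^-1 = if g \in N then t else t^-1)
    /\ isomorphic (amalgam i1 i2) (semidirect th).
Proof.
case: cases => [[[[q1 isoG]|[q2 isoG]] isoH]|[q6 q_even isoG isoH]
               |[_ isoG isoH isoK]|[isoG isoH]].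
- exact: (case_cyclic inj1 inj2 index1 index2 hN q1 isoG isoH).
- exact: (case_dicyclic_cyclic inj1 inj2 index1 index2 hN q2 isoG isoH).
- exact: (case_dicyclic_dicyclic inj1 inj2 index1 index2 hN q6 q_even isoG
            isoH).
- have exp4 (i : {morphism [set: H] >-> G}) :
      {in i @* [set: H], forall n, n ^+ 4 = 1}.
    move=> _ /morphimP[h _ _ ->].
    by rewrite -morphX ?inE // (dicyclic2_exp4 _ isoH) morph1.
  apply: (sign_semidirect_iso isoK).
  by case: hN => ->; [apply: (K1_sign_semidirect index1)
                     | apply: (K1_sign_semidirect index2)] => //; apply: exp4.
- exact: (case_octahedral inj1 inj2 index1 index2 hN isoG isoH).
Qed.
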